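(* Let $L$ be a self-adjoint positive definite operator in a Hilbert space $\mathbf{H}$ for which the sampling assumption described in the context holds. For a fixed $\delta\in(0,1)$ and each integer $j\ge0$ let $\{\phi^{j}_k\}_k$ be the set of vectors $\{\phi^{\omega}_k\}$ (described in the context) corresponding to $\omega=2^{j+1}$. Then the family of Paley-Wiener vectors $\Phi^{j}_k=F_j(\sqrt{L})\phi^{j}_k$ has the following properties: (1) Each vector $\Phi^{j}_k$ belongs to $\mathbf{PW}_{[2^{j-1},2^{j+1}]}(\sqrt{L})$ for $j\ge1$ (and to $\mathbf{PW}_{[0,2]}(\sqrt{L})$ for $j=0$). (2) The family $\{\Phi^{j}_k\}$ is a frame in $\mathbf{H}$ with constants $1-\delta$ and $1$: $$(1-\delta)\|f\|_{\mathbf{H}}^2\le\sum_{j\ge0}\sum_k\left|\langle f,\Phi^{j}_k\rangle\right|^2\le\|f\|_{\mathbf{H}}^2,\qquad f\in\mathbf{H}.$$ (3) The canonical dual frame $\{\Psi^{j}_k\}$ also consists of bandlimited vectors $\Psi^{j}_k\in\mathbf{PW}_{[2^{j-1},2^{j+1}]}(\sqrt{L})$ for $j\ge1$ (and $\Psi^0_k\in\mathbf{PW}_{[0,2]}(\sqrt{L})$), and has frame bounds $A=1$, $B=(1-\delta)^{-1}$. (4) For every $f\in\mathbf{H}$ the reconstruction formulas hold: $$f=\sum_j\sum_k\langle f,\Phi^{j}_k\rangle\Psi^{j}_k=\sum_j\sum_k\langle f,\Psi^{j}_k\rangle\Phi^{j}_k.$$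
   Context: $\mathbf{H}^m$ is the domain of $L^{m/2}$. $\mathcal{F}$ (Spectral Fourier Transform) is the unitary map from $\mathbf{H}$ onto a direct integral $\int X(\lambda)\,dm(\lambda)$ with $\mathcal{F}(L^{k/2}f)(\lambda)=\lambda^k(\mathcal{F}f)(\lambda)$. For an interval $[a,b]\subset[0,\infty)$, $\mathbf{PW}_{[a,b]}(\sqrt{L})$ is the space of $f\in\mathbf{H}$ with $\mathcal{F}f$ supported in $[a,b]$; $\mathbf{PW}_{\omega}(\sqrt{L})=\mathbf{PW}_{[0,\omega]}(\sqrt{L})$. For bounded measurable $F$ on $[0,\infty)$, $F(\sqrt{L})f=\mathcal{F}^{-1}F(\lambda)\mathcal{F}f$. Sampling assumption: there exist $C,c>0$ and $m_0\ge0$ such that for any $0<\rho<1$ there is a set of functionals $\{\mathcal{A}^{(\rho)}_k\}_k$ on $\mathbf{H}^{m_0}$ with $$c\sum_k|\mathcal{A}^{(\rho)}_k(f)|^2\le\|f\|_{\mathbf{H}}^2\le C\left(\sum_k|\mathcal{A}^{(\rho)}_k(f)|^2+\rho^{2m}\|L^{m/2}f\|_{\mathbf{H}}^2\right)$$ for all $f\in\mathbf{H}^m$, $m>m_0$. The vectors $\phi^{\omega}_k$: given $\omega>0$ and $\delta\in(0,1)$, choose $\rho$ with $\rho^{2m}=C^{-1}\omega^{-2m}\delta$; let $\mu_k\in\mathbf{H}$ be vectors with $\langle f,\mu_k\rangle=\mathcal{A}^{(\rho)}_k(f)$ for $f\in\mathbf{H}^m$, $m>m_0$; then $\phi^{\omega}_k=\mathcal{P}_{\omega}\mu_k$,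 where $\mathcal{P}_{\omega}$ is the orthogonal projection onto $\mathbf{PW}_{\omega}(\sqrt{L})$. The functions $F_j$: let $g\in C^\infty(\mathbb{R}_+)$ be non-increasing with $\mathrm{supp}(g)\subset[0,2]$, $g=1$ on $[0,1]$, $0\le g\le1$; $h(\lambda)=g(\lambda)-g(2\lambda)$; $F_0(\lambda)=\sqrt{g(\lambda)}$, $F_j(\lambda)=\sqrt{h(2^{-j}\lambda)}$ for $j\ge1$, so $\sum_{j\ge0}F_j^2=1$ on $[0,\infty)$. A family $\{\theta_v\}$ is a frame in $\mathbf{H}$ with bounds $A,B>0$ if $A\|f\|^2\le\sum_v|\langle f,\theta_v\rangle|^2\le B\|f\|^2$ for all $f\in\mathbf{H}$.
   Formalization: False for general c, C: the frame bounds become (1-δ)/C, 1/c and, for the canonical dual, c, C/(1-δ). That the canonical dual is bandlimited, and the printed constants, are stated only for c=C=1; for general c, C a bandlimited dual frame with both reconstruction formulas is shown to exist. *)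

(* Defs.v *)
From HB Require Import structures.
From mathcomp Require Import all_boot all_order all_algebra finmap complex.
From mathcomp Require Import all_classical all_reals all_analysis summability.

Set Implicit Arguments.
Unset Strict Implicit.
Unset Printing Implicit Defensive.

Import Order.TTheory GRing.Theory Num.Theory numFieldNormedType.Exports.

Local Open Scope classical_set_scope.
Local Open Scope complex_scope.
Local Open Scope ring_scope.

(* Complex Hilbert spaces; the inner product is linear on the left and
   conjugate-linear on the right. *)
Record hilbertType (R : realType) := Hilbert {
  hilbert_sort :> completeNormedModType R[i];
  inner : {dot hilbert_sort for (@Num.conj R[i])};
  inner_norm : forall x : hilbert_sort, `|x| ^+ 2 = inner x x }.

Arguments inner {R h}.

(* In a normed space over R[i] the library norm `|x| is a (real) element of
   R[i]; sqnorm x is the square of its real part. *)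
Definition sqnorm (R : realType) (V : normedModType R[i]) (x : V) : R :=
  complex.Re `|x| ^+ 2.

Definition sqmod (R : realType) (z : R[i]) : R :=
  complex.Re z ^+ 2 + complex.Im z ^+ 2.

(* Sums over an arbitrary index set are unconditional: convergence of the
   partial sums along the net of finite subsets. *)
Definition has_sum (R : realType) (H : hilbertType R) (V : choiceType)
  (x : V -> H) (s : H) : Prop := partial_sum x @ totally --> s.

Definition frame (R : realType) (H : hilbertType R) (V : choiceType)
    (theta : V -> H) (A B : R) : Prop :=
  [/\ 0 < A, 0 < B &
   forall f : H,
     ((A * sqnorm f)%:E <=
       (\esum_(v in [set: V]) (sqmod (inner f (theta v)))%:E))%E /\
     ((\esum_(v in [set: V]) (sqmod (inner f (theta v)))%:E) <=
       (B * sqnorm f)%:E)%E].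

Definition frame_operator (R : realType) (H : hilbertType R) (V : choiceType)
    (theta : V -> H) (f : H) : H :=
  summability.sum (fun v => inner f (theta v) *: theta v).

(* S^-1 theta_v, with S the frame operator of theta. *)
Definition canonical_dual (R : realType) (H : hilbertType R) (V : choiceType)
    (theta : V -> H) (v : V) : H :=
  xget 0 [set p | frame_operator theta p = theta v].

Definition reconstruction (R : realType) (H : hilbertType R) (V : choiceType)
    (theta psi : V -> H) : Prop :=
  forall f : H, has_sum (fun v => inner f (theta v) *: psi v) f.

Definition subspace (R : realType) (H : hilbertType R) (D : set H) : Prop :=
  D 0 /\ forall (a : R[i]) (f g : H), D f -> D g -> D (a *: f + g).

(* An unbounded operator is a total function L together with its domain D;
   the values of L off D are irrelevant.  The last clause says that the graph
   of the adjoint is the graph of L. *)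
Definition self_adjoint (R : realType) (H : hilbertType R)
    (D : set H) (L : H -> H) : Prop :=
  [/\ subspace D, dense D,
   forall (a : R[i]) (f g : H), D f -> D g -> L (a *: f + g) = a *: L f + L g &
   forall g h : H,
     (forall f, D f -> inner (L f) g = inner f h) <-> (D g /\ L g = h)].

(* Only <L f, f> >= 0 is required, so that 0 may belong to the spectrum. *)
Definition positive (R : realType) (H : hilbertType R)
    (D : set H) (L : H -> H) : Prop :=
  forall f, D f -> 0 <= inner (L f) f.

(* A measurable field of Hilbert spaces over [0, +oo[ (fibers at negative
   points play no role): the measurable structure is given by a fundamental
   sequence of fields, total in every fiber. *)
Definition cmeasurable (R : realType) (u : R -> R[i]) : Prop :=
  measurable_fun `[(0 : R), +oo[ (fun l : R => complex.Re (u l)) /\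
  measurable_fun `[(0 : R), +oo[ (fun l : R => complex.Im (u l)).

Record direct_integral (R : realType) := DirectIntegral {
  base : {sigma_finite_measure set (measurableTypeR R) -> \bar R};
  fiber : R -> hilbertType R;
  fundamental : nat -> forall l : R, fiber l;
  fundamental_measurable : forall i j : nat,
    cmeasurable (fun l => inner (fundamental i l) (fundamental j l));
  fundamental_total : forall l : R, 0 <= l ->
    dense [set x : fiber l | exists (n : nat) (a : 'I_n -> R[i]),
                       x = \sum_(i < n) a i *: fundamental i l] }.

Definition vfield (R : realType) (X : direct_integral R) : Type :=
  forall l : R, fiber X l.

Definition vfield_eq (R : realType) (X : direct_integral R)
    (x y : vfield X) : Prop :=
  {ae base X, forall l : R, 0 <= l -> x l = y l}.

Definition vfield_sqnorm (R : realType) (X : direct_integral R)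
    (x : vfield X) : \bar R :=
  (\int[base X]_(l in `[0%R : R, +oo[) (sqnorm (x l))%:E)%E.

(* The elements of the direct integral are the square-integrable measurable
   fields, identified when they are equal almost everywhere (vfield_eq). *)
Definition in_direct_integral (R : realType) (X : direct_integral R)
    (x : vfield X) : Prop :=
  (forall n, cmeasurable (fun l => inner (x l) (fundamental X n l))) /\
  (vfield_sqnorm x < +oo)%E.

Definition multiply (R : realType) (X : direct_integral R)
    (w : R -> R) (x : vfield X) : vfield X :=
  fun l => (w l)%:C *: x l.

Definition unitary_transform (R : realType) (H : hilbertType R)
    (X : direct_integral R) (F : H -> vfield X) : Prop :=
  [/\ forall f, in_direct_integral (F f),
      forall (a : R[i]) (f g : H),
        vfield_eq (F (a *: f + g)) (fun l => a *: F f l + F g l),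
      forall f, vfield_sqnorm (F f) = (sqnorm f)%:E &
      forall x, in_direct_integral x -> exists f, vfield_eq (F f) x].

(* The spectral variable l is that of the square root of L, whence l ^+ 2. *)
Definition spectral_fourier_transform (R : realType) (H : hilbertType R)
    (D : set H) (L : H -> H) (X : direct_integral R)
    (F : H -> vfield X) : Prop :=
  [/\ unitary_transform F,
      forall f, D f <-> in_direct_integral (multiply (fun l => l ^+ 2) (F f)) &
      forall f, D f -> vfield_eq (F (L f)) (multiply (fun l => l ^+ 2) (F f))].

Definition inverse_transform (R : realType) (H : hilbertType R)
    (X : direct_integral R) (F : H -> vfield X) (x : vfield X) : H :=
  xget 0 [set f | vfield_eq (F f) x].

(* w(sqrt L) f, for f such that the field w(l) (F f)(l) is in the direct
   integral (every f when w is bounded and measurable). *)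
Definition spectral_calculus (R : realType) (H : hilbertType R)
    (X : direct_integral R) (F : H -> vfield X) (w : R -> R) (f : H) : H :=
  inverse_transform F (multiply w (F f)).

(* The domain of L^(m/2), for real m >= 0, and L^(m/2) itself. *)
Definition sobolev (R : realType) (H : hilbertType R)
    (X : direct_integral R) (F : H -> vfield X) (m : R) : set H :=
  [set f | in_direct_integral (multiply (fun l => l `^ m) (F f))].

Definition half_power (R : realType) (H : hilbertType R)
    (X : direct_integral R) (F : H -> vfield X) (m : R) (f : H) : H :=
  spectral_calculus F (fun l => l `^ m) f.

Definition paley_wiener (R : realType) (H : hilbertType R)
    (X : direct_integral R) (F : H -> vfield X) (a b : R) : set H :=
  [set f | {ae base X, forall l : R, 0 <= l -> ~~ (a <= l <= b) -> F f l = 0}].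

Definition orthogonal_projection (R : realType) (H : hilbertType R)
    (V : set H) (f : H) : H :=
  xget 0 [set p | V p /\ forall g, V g -> inner (f - p) g = 0].

Definition sampling_assumption (R : realType) (H : hilbertType R)
    (X : direct_integral R) (F : H -> vfield X) (C c m0 : R)
    (K : R -> choiceType) (A : forall rho : R, K rho -> H -> R[i]) : Prop :=
  [/\ 0 < C, 0 < c, 0 <= m0 &
   forall rho : R, 0 < rho < 1 ->
    (forall (k : K rho) (a : R[i]) (f g : H),
       sobolev F m0 f -> sobolev F m0 g ->
       A rho k (a *: f + g) = a * A rho k f + A rho k g) /\
    (forall (m : R) (f : H), m0 < m -> sobolev F m f ->
       (c%:E * (\esum_(k in [set: K rho]) (sqmod (A rho k f))%:E) <=
          (sqnorm f)%:E)%E /\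
       ((sqnorm f)%:E <=
          C%:E * ((\esum_(k in [set: K rho]) (sqmod (A rho k f))%:E) +
                  (rho `^ (2 * m) * sqnorm (half_power F m f))%:E))%E)].

Definition represents (R : realType) (H : hilbertType R)
    (X : direct_integral R) (F : H -> vfield X) (m0 : R)
    (K : choiceType) (A : K -> H -> R[i]) (mu : K -> H) : Prop :=
  forall (k : K) (m : R) (f : H), m0 < m -> sobolev F m f ->
    inner f (mu k) = A k f.

(* g is only constrained on [0, +oo[.  Smoothness there is smoothness on
   ]0, +oo[, since g = 1 on [0, 1]. *)
Definition cutoff (R : realType) (g : R -> R) : Prop :=
  [/\ forall (n : nat) (x : R), 0 < x -> derivable (derive1n n g) x 1,
      forall x y : R, 0 <= x -> x <= y -> g y <= g x,
      closure [set x : R | 0 <= x /\ g x != 0] `<=` `[0, 2],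
      forall x : R, 0 <= x <= 1 -> g x = 1 &
      forall x : R, 0 <= x -> 0 <= g x <= 1].

Definition dyadic_window (R : realType) (g : R -> R) (j : nat) (l : R) : R :=
  let h := fun t => g t - g (2 * t) in
  if j is 0%N then Num.sqrt (g l) else Num.sqrt (h (l / 2 ^+ j)).

(* PW_[2^(j-1), 2^(j+1)] for j >= 1 and PW_[0, 2] for j = 0. *)
Definition dyadic_band (R : realType) (H : hilbertType R)
    (X : direct_integral R) (F : H -> vfield X) (j : nat) : set H :=
  if j is i.+1 then paley_wiener F (2 ^+ i) (2 ^+ i.+2)
  else paley_wiener F 0 2.

(* The family Phi^j_k, indexed by the pairs v = (j, k). *)
Definition multiscale_family (R : realType) (H : hilbertType R)
    (X : direct_integral R) (F : H -> vfield X) (g : R -> R)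
    (K : nat -> choiceType) (mu : forall j, K j -> H)
    (v : {j : nat & K j}) : H :=
  let j := projT1 v in
  let omega : R := 2 ^+ j.+1 in
  let phi := orthogonal_projection (paley_wiener F 0 omega)
               (mu j (projT2 v)) in
  spectral_calculus F (dyadic_window g j) phi.

(* Main.v *)
Require Import Defs.
From HB Require Import structures.
From mathcomp Require Import all_boot all_order all_algebra finmap complex.
From mathcomp Require Import all_classical all_reals all_analysis.
From mathcomp Require Import measurable_realfun summability ring lra.

(** The transform F turns functions of the square root of L into multiplication
    operators: a bounded measurable symbol w acts on H as a bounded symmetric
    operator w(sqrt L), and w(sqrt L) v(sqrt L) = (w v)(sqrt L).  Symmetry is
    obtained by integrating the pointwise identity
    |w x + y|^2 + |x - w y|^2 = |w x - y|^2 + |x + w y|^2, which requires the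
    norm of a measurable field to be measurable (measurable_sqnorm).  In
    particular the projection P_j onto the vectors of band [0, 2^(j+1)] is the
    multiplier by the indicator of that band, and the dyadic windows give
    operators M_j with P_j M_j = M_j and, their squares telescoping to one,
    sum_j |M_j f|^2 = |f|^2 (spectral_calculus_parseval).

    At level j, L^(m/2) is bounded by 2^((j+1) m) on the range of P_j, so the
    error term of the sampling inequality is at most delta |f|^2 and the vectors
    P_j mu_k form a frame of that range with bounds (1 - delta) / C and 1 / c
    (sampling_frame).  Since <f, M_j P_j mu_k> = <M_j f, P_j mu_k>, summing over
    j gives the frame inequalities for Phi with the same bounds.

    Any frame with bounds A and B of the range of a projection has a dual: the
    frame operator S is coercive there, hence invertible, and psi = S^-1 theta
    has bounds 1 / B and 1 / A (frame_on_dual).  Taking the whole space gives the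
    canonical dual Psi.  Taking the duals psi_(j,k) of the levels and filtering
    them again, Theta_(j,k) = M_j psi_(j,k), gives the band-limited dual
    (glued_family_dual).  Both pairs of reconstruction formulas rest on one
    criterion (reconstruction_polar): Bessel families Phi and Theta are dual as
    soon as, for all f and y,
      sum_v |<f, Phi_v> + <y, Theta_v>|^2 + |f - y|^2
      = sum_v |<f, Phi_v> - <y, Theta_v>|^2 + |f + y|^2.
    All terms are nonnegative, so the sums may be regrouped by levels.

    When C = c = 1, the sampling inequality, valid at every order m > m0, can be
    used with m tending to infinity: rho 2^(j+1) < 1, so the error term
    disappears and the frame of each level is tight (sampling_tight).  Then Phi
    is a Parseval frame, its frame operator is the identity and Psi = Phi, which
    is band-limited. *)

Import Order.TTheory GRing.Theory Num.Theory numFieldNormedType.Exports.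

Local Open Scope classical_set_scope.
Local Open Scope complex_scope.
Local Open Scope ring_scope.

(** * The real inner product of a complex Hilbert space *)

Section RealInnerProduct.
Context {R : realType} {H : hilbertType R}.
Implicit Types (x y z : H) (a b : R[i]) (r : R).

(** Norms, convergence and frame inequalities only involve the real part of the
    inner product; inner_ext below recovers the complex one. *)
Definition rdot x y : R := complex.Re (inner x y).

Lemma innerDl x y z : inner (x + y) z = inner x z + inner y z.
Proof. exact: linearDl. Qed.

Lemma innerNl x y : inner (- x) y = - inner x y.
Proof. exact: linearNl. Qed.

Lemma innerBl x y z : inner (x - y) z = inner x z - inner y z.
Proof. exact: linearBl. Qed.

Lemma innerDr x y z : inner x (y + z) = inner x y + inner x z.
Proof. exact: linearDr. Qed.

Lemma innerZl a x y : inner (a *: x) y = a * inner x y.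
Proof. by rewrite linearZl_LR. Qed.

Lemma innerZr a x y : inner x (a *: y) = a^* * inner x y.
Proof. by rewrite linearZr_LR. Qed.

Lemma innerC x y : inner x y = (inner y x)^*.
Proof. by rewrite (hermC inner) expr0 mul1r. Qed.

Lemma Re_conjc a : complex.Re a^* = complex.Re a.
Proof. by case: a. Qed.

Lemma Im_conjc a : complex.Im a^* = - complex.Im a.
Proof. by case: a. Qed.

Lemma norm_real x : `|x| = (complex.Re `|x|)%:C.
Proof. by rewrite RRe_real// normr_real. Qed.

Lemma inner_self x : inner x x = (sqnorm x)%:C.
Proof. by rewrite -inner_norm norm_real /sqnorm /= rmorphXn. Qed.

Lemma sqnormE x : sqnorm x = rdot x x.
Proof. by rewrite /rdot inner_self. Qed.

Lemma sqnorm_ge0 x : 0 <= sqnorm x.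
Proof. exact: sqr_ge0. Qed.

Lemma sqnorm_eq0 x : sqnorm x = 0 -> x = 0.
Proof.
move=> x0; apply/eqP; rewrite -normr_eq0 -sqrf_eq0 norm_real -rmorphXn/=.
by rewrite -/(sqnorm x) x0.
Qed.

Lemma rdotC x y : rdot x y = rdot y x.
Proof. by rewrite /rdot innerC Re_conjc. Qed.

Lemma rdotDl x y z : rdot (x + y) z = rdot x z + rdot y z.
Proof. by rewrite /rdot innerDl raddfD. Qed.

Lemma rdotDr x y z : rdot x (y + z) = rdot x y + rdot x z.
Proof. by rewrite /rdot innerDr raddfD. Qed.

Lemma ReZ r a : complex.Re (r%:C * a) = r * complex.Re a.
Proof. by case: a => u v /=; rewrite mul0r subr0. Qed.

Lemma ImZ r a : complex.Im (r%:C * a) = r * complex.Im a.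
Proof. by case: a => u v /=; rewrite mul0r addr0. Qed.

Lemma rdotZl r x y : rdot (r%:C *: x) y = r * rdot x y.
Proof. by rewrite /rdot innerZl ReZ. Qed.

Lemma rdotZr r x y : rdot x (r%:C *: y) = r * rdot x y.
Proof. by rewrite rdotC rdotZl rdotC. Qed.

Lemma rdotNl x y : rdot (- x) y = - rdot x y.
Proof. by rewrite -scaleN1r -[-1](rmorphN1 (real_complex R)) rdotZl mulN1r. Qed.

Lemma rdotNr x y : rdot x (- y) = - rdot x y.
Proof. by rewrite rdotC rdotNl rdotC. Qed.

Lemma rdot0l y : rdot 0 y = 0.
Proof. by rewrite -(scale0r (0 : H)) -[0](rmorph0 (real_complex R)) rdotZl mul0r. Qed.

Lemma rdotBl x y z : rdot (x - y) z = rdot x z - rdot y z.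
Proof. by rewrite rdotDl rdotNl. Qed.

Lemma Im_inner x y : complex.Im (inner x y) = rdot x ('i%C *: y).
Proof.
rewrite /rdot innerZr; case: (inner x y) => u v /=.
by rewrite mul0r sub0r mulN1r opprK.
Qed.

(** The imaginary part of an inner product is the real part after multiplying
    the second argument by i. *)
Lemma inner_ext x y x' y' :
  rdot x y = rdot x' y' -> rdot x ('i%C *: y) = rdot x' ('i%C *: y') ->
  inner x y = inner x' y'.
Proof.
rewrite -!Im_inner /rdot; case: (inner x y) => u v; case: (inner x' y') => u' v'.
by move=> /= -> ->.
Qed.

Lemma rdot_ext x x' : (forall y, rdot x y = rdot x' y) -> x = x'.
Proof.
move=> xx'; apply/eqP; rewrite -subr_eq0; apply/eqP/sqnorm_eq0.
by rewrite sqnormE rdotBl xx' subrr.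
Qed.

Lemma sqnormD x y : sqnorm (x + y) = sqnorm x + 2 * rdot x y + sqnorm y.
Proof. rewrite !sqnormE rdotDl !rdotDr (rdotC y x); ring. Qed.

Lemma sqnormN x : sqnorm (- x) = sqnorm x.
Proof. by rewrite !sqnormE rdotNl rdotNr opprK. Qed.

Lemma sqnormB x y : sqnorm (x - y) = sqnorm x - 2 * rdot x y + sqnorm y.
Proof. rewrite sqnormD sqnormN rdotNr; ring. Qed.

Lemma sqnormBC x y : sqnorm (x - y) = sqnorm (y - x).
Proof. by rewrite -sqnormN opprB. Qed.

Lemma sqnorm0 : sqnorm (0 : H) = 0.
Proof. by rewrite sqnormE rdot0l. Qed.

Lemma sqnormZ a x : sqnorm (a *: x) = sqmod a * sqnorm x.
Proof.
rewrite sqnormE /rdot innerZl innerZr inner_self mulrA.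
by case: a => u v; rewrite /sqmod /=; ring.
Qed.

Lemma sqmodC r : sqmod r%:C = r ^+ 2.
Proof. by rewrite /sqmod /= expr0n addr0. Qed.

Lemma sqmod_ge0 a : 0 <= sqmod a.
Proof. by rewrite addr_ge0// sqr_ge0. Qed.

Lemma sqnormZr r x : sqnorm (r%:C *: x) = r ^+ 2 * sqnorm x.
Proof. by rewrite sqnormZ sqmodC. Qed.

(** Cauchy-Schwarz before optimizing the weight t: choosing t suitably lets one
    of the two terms be absorbed, and square roots never appear. *)
Lemma rdot_young t x y : 0 < t -> 2 * rdot x y <= t * sqnorm x + t^-1 * sqnorm y.
Proof.
move=> t0; have := sqnorm_ge0 (t%:C *: x - y).
rewrite sqnormB sqnormZr rdotZl => h.
rewrite -(ler_pM2l t0).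
have -> : t * (t * sqnorm x + t^-1 * sqnorm y) = t ^+ 2 * sqnorm x + sqnorm y.
  by field; rewrite gt_eqF.
lra.
Qed.

Lemma sqnormD_le x y : sqnorm (x + y) <= 2 * sqnorm x + 2 * sqnorm y.
Proof.
have := @rdot_young 1 x y ltr01; rewrite sqnormD invr1 !mul1r; lra.
Qed.
End RealInnerProduct.

(** * Convergence in a Hilbert space *)

Section HilbertConvergence.
Context {R : realType} {H : hilbertType R}.

Lemma norm_lt_sqnorm (x : H) (e : R) : 0 < e -> (`|x| < e%:C) = (sqnorm x < e ^+ 2).
Proof.
move=> e0; rewrite norm_real ltcR /sqnorm ltr_pXn2r// ?nnegrE; last exact: ltW.
by rewrite -ler0c -norm_real normr_ge0.
Qed.

Lemma pos_real (e : R[i]) : 0 < e -> e = (complex.Re e)%:C /\ 0 < complex.Re e.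
Proof.
move=> e0; have er : e = (complex.Re e)%:C.
  by rewrite RRe_real// gtr0_real.
by split=> //; rewrite -[0 < _]ltcR -er.
Qed.

Lemma cvg_sqnormP {T : Type} (Fi : set_system T) {FF : Filter Fi} (x : T -> H) (l : H) :
  x @ Fi --> l <-> forall e : R, 0 < e -> \forall t \near Fi, sqnorm (l - x t) < e.
Proof.
rewrite cvgrPdist_lt; split=> h e e0.
  have := h (Num.sqrt e)%:C; rewrite ltcR sqrtr_gt0 => /(_ e0).
  apply: filterS => t; rewrite norm_lt_sqnorm ?sqrtr_gt0//.
  by rewrite sqr_sqrtr// ltW.
have [-> r0] := pos_real e e0.
have := h (complex.Re e ^+ 2) (exprn_gt0 2 r0).
by apply: filterS => t; rewrite norm_lt_sqnorm.
Qed.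

(** Stated for an arbitrary filter, so as to serve both the nets of finite
    partial sums and the iterates of a contraction. *)
Lemma hilbert_complete {T : Type} (Fi : set_system T) {FF : ProperFilter Fi}
    (x : T -> H) :
  (forall e : R, 0 < e ->
     exists2 A : set T, Fi A & forall s t, A s -> A t -> sqnorm (x s - x t) < e) ->
  exists l : H, x @ Fi --> l.
Proof.
move=> hx; apply/cvg_ex/cauchy_cvgP/cauchy_ballP => e e0.
have [eE r0] := pos_real e e0.
have [A FA hA] := hx _ (exprn_gt0 2 r0).
exists (x @` A, x @` A).
  by split; apply: (@filterS _ Fi _ A) FA => t At /=; exists t.
move=> [_ _] [[s As <-] [t At <-]] /=.
by rewrite -ball_normE /ball_/= eE norm_lt_sqnorm//; exact: hA.
Qed.

Lemma cvg_rdot {T : Type} (Fi : set_system T) {FF : Filter Fi} (x : T -> H) (l y : H) :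
  x @ Fi --> l -> (fun t => rdot (x t) y) @ Fi --> rdot l y.
Proof.
move=> /cvg_sqnormP xl; apply/cvgrPdist_lt => e e0.
have Y0 : 0 < sqnorm y + 1 by rewrite ltr_wpDl// sqnorm_ge0.
have d0 : 0 < e ^+ 2 / (sqnorm y + 1) by rewrite divr_gt0// exprn_gt0.
have := xl _ d0; apply: filterS => t; rewrite -rdotBl.
set d := l - x t => hd.
have k0 : 0 < (sqnorm y + 1) / e by rewrite divr_gt0.
have := rdot_young _ d y k0; have := rdot_young _ (- d) y k0.
rewrite sqnormN rdotNl invf_div.
have : (sqnorm y + 1) / e * sqnorm d < e.
  rewrite mulrAC ltr_pdivrMr// -expr2 -[ltRHS]mulr1.
  by rewrite mulrC -ltr_pdivlMr// mulr1.
have : e / (sqnorm y + 1) * sqnorm y < e.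
  by rewrite mulrAC ltr_pdivrMr// ltr_pM2l// ltrDl.
by move=> h1 h2 h3 h4; rewrite ltr_norml; apply/andP; split; lra.
Qed.

Lemma cvg_sqnorm_le {T : Type} (Fi : set_system T) {FF : ProperFilter Fi}
    (x : T -> H) (l : H) (M : R) :
  x @ Fi --> l -> (\forall t \near Fi, sqnorm (x t) <= M) -> sqnorm l <= M.
Proof.
move=> xl xM.
have hl : (fun t => rdot (x t) l) @ Fi --> sqnorm l.
  by rewrite sqnormE; exact: cvg_rdot.
(* |l|^2 is the limit of Re <x t, l>, which is at most (|x t|^2 + |l|^2) / 2 *)
suff : sqnorm l <= (M + sqnorm l) / 2 by lra.
apply: (@closed_cvg _ _ Fi FF _ [set r | r <= (M + sqnorm l) / 2] _ _ _ hl).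
  exact: closed_le.
apply: filterS xM => t xtM /=.
have := @rdot_young _ _ 1 (x t) l ltr01; rewrite invr1 !mul1r; lra.
Qed.
End HilbertConvergence.

(** * Unconditional sums *)

#[local] Existing Instance totally_filter.

Section UnconditionalSums.
Context {R : realType} {V : choiceType}.
Implicit Types (J : {fset V}) (a : V -> R).

Lemma partial_sumE {W : zmodType} (x : V -> W) J :
  partial_sum x J = \sum_(v <- J) x v.
Proof. by rewrite /partial_sum big_seq_fsetE. Qed.

Lemma sum_fset_sub {W : zmodType} (x : V -> W) (J0 J : {fset V}) :
  (J0 `<=` J)%fset ->
  \sum_(v <- J) x v = \sum_(v <- J0) x v + \sum_(v <- (J `\` J0)%fset) x v.
Proof.
move=> sJ; rewrite (bigID (fun v => v \in J0))/=; congr (_ + _).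
  rewrite -big_filter; apply: perm_big; apply: uniq_perm => //.
    by rewrite filter_uniq.
  move=> v; rewrite mem_filter andb_idr//.
  by move=> vJ0; exact: (fsubsetP sJ).
rewrite -big_filter; apply: perm_big; apply: uniq_perm => //.
  by rewrite filter_uniq.
by move=> v; rewrite mem_filter in_fsetD.
Qed.

Lemma sum_le_esum a J : (forall v, 0 <= a v) ->
  ((\sum_(v <- J) a v)%:E <= \esum_(v in [set: V]) (a v)%:E)%E.
Proof.
move=> a0; apply: ereal_sup_ubound; exists [set` J].
  by split=> //; exact: finite_fset.
by rewrite fsbig_finite//= set_fsetK sumEFin.
Qed.

Lemma esum_le_bound a (M : R) : (forall J, \sum_(v <- J) a v <= M) ->
  (\esum_(v in [set: V]) (a v)%:E <= M%:E)%E.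
Proof.
move=> h; apply: ge_ereal_sup => _ [X [fX _] <-].
by rewrite fsbig_finite// sumEFin lee_fin.
Qed.

Lemma esum_fin_num a : (forall v, 0 <= a v) ->
  (\esum_(v in [set: V]) (a v)%:E < +oo)%E ->
  \esum_(v in [set: V]) (a v)%:E \is a fin_num.
Proof.
by move=> a0 h; rewrite ge0_fin_numE// esum_ge0// => v _; rewrite lee_fin.
Qed.

Lemma sum_near_esum a (e : R) : (forall v, 0 <= a v) -> 0 < e ->
  (\esum_(v in [set: V]) (a v)%:E < +oo)%E ->
  exists J0, forall J, (J0 `<=` J)%fset ->
    fine (\esum_(v in [set: V]) (a v)%:E) - e < \sum_(v <- J) a v <=
    fine (\esum_(v in [set: V]) (a v)%:E).
Proof.
move=> a0 e0 fin; have fn := esum_fin_num _ a0 fin.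
have : ((fine (\esum_(v in [set: V]) (a v)%:E) - e)%:E <
        \esum_(v in [set: V]) (a v)%:E)%E.
  by rewrite -[ltRHS](fineK fn) lte_fin ltrBlDr ltrDl.
move=> /ereal_sup_gt[_ [X [fX _] <-]].
rewrite fsbig_finite// sumEFin lte_fin => hX.
exists (fset_set X) => J sJ; apply/andP; split; last first.
  by rewrite -lee_fin fineK//; exact: sum_le_esum.
rewrite (lt_le_trans hX)// (sum_fset_sub _ _ _ sJ) lerDl.
by rewrite sumr_ge0.
Qed.

Lemma cvg_esum a : (forall v, 0 <= a v) ->
  (\esum_(v in [set: V]) (a v)%:E < +oo)%E ->
  (fun J => \sum_(v <- J) a v) @ totally --> fine (\esum_(v in [set: V]) (a v)%:E).
Proof.
move=> a0 fin; apply/cvgrPdist_lt => e e0.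
have [J0 hJ0] := sum_near_esum _ _ a0 e0 fin.
exists J0 => // J /= /hJ0 /andP[h1 h2].
by rewrite ger0_norm ?subr_ge0// ltrBlDr addrC -ltrBlDr.
Qed.

End UnconditionalSums.

(** * Bessel families and their frame operators *)

Section BesselFamilies.
Context {R : realType} {H : hilbertType R} {V : choiceType}.
Implicit Types (theta : V -> H) (f g y s : H) (a : V -> R[i]).

(** The middle term of the frame inequalities; it is the quadratic form of the
    frame operator. *)
Definition energy theta f : \bar R :=
  \esum_(v in [set: V]) (sqmod (inner f (theta v)))%:E.

Definition bessel theta (B : R) :=
  0 < B /\ forall f, (energy theta f <= (B * sqnorm f)%:E)%E.

Lemma bessel_lty theta B f : bessel theta B -> (energy theta f < +oo)%E.
Proof. by case=> _ h; rewrite (le_lt_trans (h f))// ltry. Qed.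

Lemma energy_fin_num theta B f : bessel theta B -> energy theta f \is a fin_num.
Proof.
by move=> h; rewrite esum_fin_num//; [move=> v; exact: sqmod_ge0|exact: (bessel_lty _ _ _ h)].
Qed.

Lemma sum_le_energy theta f (J : {fset V}) :
  ((\sum_(v <- J) sqmod (inner f (theta v)))%:E <= energy theta f)%E.
Proof. by apply: sum_le_esum => v; exact: sqmod_ge0. Qed.

Lemma polarC (a b : R[i]) :
  4 * complex.Re (a * b^*) = sqmod (a + b) - sqmod (a - b).
Proof. case: a => u v; case: b => u' v'; rewrite /sqmod /=; ring. Qed.

Lemma rdot_suml (J : {fset V}) a theta y :
  rdot (\sum_(v <- J) a v *: theta v) y =
  \sum_(v <- J) complex.Re (a v * (inner y (theta v))^*).
Proof.
elim/big_rec2: _ => [|v r x _ <-]; first exact: rdot0l.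
by rewrite rdotDl /rdot innerZl [inner (theta v) y]innerC.
Qed.

(** The synthesis operator is bounded by the square root of the Bessel bound:
    test the sum y against itself and absorb the energy of y. *)
Lemma sqnorm_synthesis theta B a (J : {fset V}) : bessel theta B ->
  sqnorm (\sum_(v <- J) a v *: theta v) <= B * \sum_(v <- J) sqmod (a v).
Proof.
move=> [B0 hB]; set y := \sum_(v <- J) _.
have Ey : \sum_(v <- J) sqmod (inner y (theta v)) <= B * sqnorm y.
  by rewrite -lee_fin (le_trans (sum_le_energy _ _ _) (hB y)).
suff : 2 * sqnorm y <= B * \sum_(v <- J) sqmod (a v) +
    B^-1 * \sum_(v <- J) sqmod (inner y (theta v)).
  move=> h; have : B^-1 * \sum_(v <- J) sqmod (inner y (theta v)) <= sqnorm y.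
    by rewrite ler_pdivrMl.
  lra.
rewrite {1}sqnormE {1}/y rdot_suml !mulr_sumr -big_split/=.
apply: ler_sum => v _; set b := inner y _.
have : 0 <= B^-1 * sqmod (B%:C * a v - b) by rewrite mulr_ge0 ?invr_ge0 ?sqmod_ge0// ltW.
move: (a v) b => [p q] [p' q']; rewrite /sqmod /= => h.
have -> : B * (p ^+ 2 + q ^+ 2) + B^-1 * (p' ^+ 2 + q' ^+ 2) =
  B^-1 * ((B * p - 0 * q - p') ^+ 2 + (B * q + 0 * p - q') ^+ 2) +
  2 * (p * p' - q * - q') by field; rewrite gt_eqF.
lra.
Qed.

(** Beyond a finite set that carries almost all of the l2 norm of the
    coefficients, the synthesis bound makes the partial sums vary little. *)
Lemma bessel_has_sum theta B a : bessel theta B ->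
  (\esum_(v in [set: V]) (sqmod (a v))%:E < +oo)%E ->
  exists s, has_sum (fun v => a v *: theta v) s.
Proof.
move=> hB fin; apply: hilbert_complete => e e0.
have [B0 _] := hB.
have d0 : 0 < e / (4 * B) by rewrite divr_gt0// mulr_gt0.
have [J0 hJ0] := sum_near_esum _ _ (fun v => sqmod_ge0 (a v)) d0 fin.
have near0 J : (J0 `<=` J)%fset ->
    sqnorm (partial_sum (fun v => a v *: theta v) J -
            partial_sum (fun v => a v *: theta v) J0) < e / 4.
  move=> sJ; rewrite !partial_sumE (sum_fset_sub _ _ _ sJ) addrC addKr.
  rewrite (le_lt_trans (sqnorm_synthesis _ _ _ _ hB))//.
  have -> : e / 4 = B * (e / (4 * B)) by field; rewrite gt_eqF.
  rewrite ltr_pM2l//.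
  have /andP[h1 _] := hJ0 _ (fsubset_refl J0).
  have /andP[_] := hJ0 _ sJ; rewrite (sum_fset_sub _ _ _ sJ).
  lra.
exists [set J | (J0 `<=` J)%fset]; first by exists J0.
move=> s t /near0 hs /near0 ht.
set x := partial_sum _ in hs ht *.
have -> : x s - x t = (x s - x J0) + (x J0 - x t) by rewrite addrA subrK.
rewrite (le_lt_trans (sqnormD_le _ _))// [sqnorm (x J0 - x t)]sqnormBC; lra.
Qed.

Lemma has_sum_sqnorm_le theta B a s : bessel theta B ->
  has_sum (fun v => a v *: theta v) s ->
  (\esum_(v in [set: V]) (sqmod (a v))%:E < +oo)%E ->
  sqnorm s <= B * fine (\esum_(v in [set: V]) (sqmod (a v))%:E).
Proof.
move=> hB hs fin; apply: (cvg_sqnorm_le _ _ _ _ hs).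
apply: nearW => J; rewrite partial_sumE.
apply: (le_trans (sqnorm_synthesis _ _ _ _ hB)).
have a0 v := sqmod_ge0 (a v).
by rewrite ler_pM2l ?hB.1// -lee_fin fineK ?sum_le_esum ?esum_fin_num.
Qed.

Lemma esum_sqmodD_lty (a b : V -> R[i]) :
  (\esum_(v in [set: V]) (sqmod (a v))%:E < +oo)%E ->
  (\esum_(v in [set: V]) (sqmod (b v))%:E < +oo)%E ->
  (\esum_(v in [set: V]) (sqmod (a v + b v))%:E < +oo)%E.
Proof.
move=> ha hb; have a0 v := sqmod_ge0 (a v); have b0 v := sqmod_ge0 (b v).
apply: (@le_lt_trans _ _ (2 * fine (\esum_(v in [set: V]) (sqmod (a v))%:E) +
   2 * fine (\esum_(v in [set: V]) (sqmod (b v))%:E))%:E); last exact: ltry.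
apply: esum_le_bound => J.
apply: (@le_trans _ _ (2 * \sum_(v <- J) sqmod (a v) + 2 * \sum_(v <- J) sqmod (b v))).
  rewrite !mulr_sumr -big_split/=; apply: ler_sum => v _.
  case: (a v) => p q; case: (b v) => p' q'; rewrite /sqmod/=.
  have := sqr_ge0 (p - p'); have := sqr_ge0 (q - q'); lra.
by apply: lerD; rewrite ler_pM2l// -lee_fin fineK ?sum_le_esum ?esum_fin_num.
Qed.

Lemma sqmodN (a : R[i]) : sqmod (- a) = sqmod a.
Proof. by case: a => p q; rewrite /sqmod /= !sqrrN. Qed.

Lemma sqmod_i (a : R[i]) : sqmod ('i%C * a) = sqmod a.
Proof. case: a => p q; rewrite /sqmod /=; ring. Qed.

(** Polarization turns the inner products of an unconditional sum into
    differences of sums of nonnegative terms. *)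
Lemma has_sum_polar theta B a s y : bessel theta B ->
  (\esum_(v in [set: V]) (sqmod (a v))%:E < +oo)%E ->
  has_sum (fun v => a v *: theta v) s ->
  (\esum_(v in [set: V]) (sqmod (a v + inner y (theta v)))%:E =
   \esum_(v in [set: V]) (sqmod (a v - inner y (theta v)))%:E +
   (4 * rdot s y)%:E)%E.
Proof.
move=> hB fin hs; set b := fun v => inner y (theta v).
have finb : (\esum_(v in [set: V]) (sqmod (b v))%:E < +oo)%E by exact: bessel_lty hB.
have finNb : (\esum_(v in [set: V]) (sqmod (- b v))%:E < +oo)%E.
  by under eq_esum do rewrite sqmodN.
have p0 v := sqmod_ge0 (a v + b v); have m0 v := sqmod_ge0 (a v - b v).
have finp := esum_sqmodD_lty _ _ fin finb.
have finm := esum_sqmodD_lty _ _ fin finNb.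
rewrite -(fineK (esum_fin_num _ p0 finp)) -(fineK (esum_fin_num _ m0 finm)) -EFinD.
congr EFin; apply/eqP; rewrite addrC -subr_eq; apply/eqP.
have c1 : (fun J : {fset V} => \sum_(v <- J) sqmod (a v + b v) -
      \sum_(v <- J) sqmod (a v - b v)) @ totally -->
    fine (\esum_(v in [set: V]) (sqmod (a v + b v))%:E) -
    fine (\esum_(v in [set: V]) (sqmod (a v - b v))%:E).
  by apply: cvgB; exact: cvg_esum.
have c2 : (fun J : {fset V} => 4 * rdot (partial_sum (fun v => a v *: theta v) J) y)
    @ totally --> 4 * rdot s y.
  by apply: cvgMr; exact: cvg_rdot.
apply: (norm_cvg_unique c1).
apply: cvg_trans c2; apply: near_eq_cvg; apply: nearW => J /=.
rewrite partial_sumE rdot_suml mulr_sumr -sumrB.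
by apply: eq_bigr => v _; exact: polarC.
Qed.

(** Two Bessel families are dual as soon as the polarized energy identity
    holds; being an identity between sums of nonnegative terms, it can be
    checked by regrouping the index set. *)
Lemma reconstruction_polar (Phi Theta : V -> H) B B' :
  bessel Phi B -> bessel Theta B' ->
  (forall f y,
    (\esum_(v in [set: V]) (sqmod (inner f (Phi v) + inner y (Theta v)))%:E +
       (sqnorm (f - y))%:E =
     \esum_(v in [set: V]) (sqmod (inner f (Phi v) - inner y (Theta v)))%:E +
       (sqnorm (f + y))%:E)%E) ->
  reconstruction Phi Theta.
Proof.
move=> hP hT polar f.
have finP : (\esum_(v in [set: V]) (sqmod (inner f (Phi v)))%:E < +oo)%E.
  exact: bessel_lty hP.
have [s hs] := bessel_has_sum _ _ _ hT finP.
suff sf : s = f by rewrite sf in hs.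
apply: rdot_ext => y; have := polar f y.
rewrite (has_sum_polar _ _ _ _ y hT finP hs).
have fin : \esum_(v in [set: V]) (sqmod (inner f (Phi v) - inner y (Theta v)))%:E
    \is a fin_num.
  rewrite esum_fin_num//; first by move=> v; exact: sqmod_ge0.
  apply: esum_sqmodD_lty => //; under eq_esum do rewrite sqmodN.
  exact: bessel_lty hT.
rewrite -(fineK fin) -!EFinD => -[]; rewrite sqnormB sqnormD; lra.
Qed.

Lemma reconstruction_polarC (Phi Theta : V -> H) B B' :
  bessel Phi B -> bessel Theta B' ->
  (forall f y,
    (\esum_(v in [set: V]) (sqmod (inner f (Phi v) + inner y (Theta v)))%:E +
       (sqnorm (f - y))%:E =
     \esum_(v in [set: V]) (sqmod (inner f (Phi v) - inner y (Theta v)))%:E +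
       (sqnorm (f + y))%:E)%E) ->
  reconstruction Phi Theta /\ reconstruction Theta Phi.
Proof.
move=> hP hT polar; split; first exact: (reconstruction_polar _ _ _ _ hP hT).
apply: (reconstruction_polar _ _ _ _ hT hP) => f y; have := polar y f.
rewrite [sqnorm (y - f)]sqnormBC [y + f]addrC.
under eq_esum do rewrite addrC.
move=> ->; congr (_ + _)%E.
by apply: eq_esum => v _; rewrite -sqmodN opprB.
Qed.

Section FrameOperator.
Context (theta : V -> H) (B : R) (hB : bessel theta B).
Let S := frame_operator theta.

Lemma frame_operator_has_sum f : has_sum (fun v => inner f (theta v) *: theta v) (S f).
Proof.
have [s hs] := bessel_has_sum _ _ _ hB (bessel_lty _ _ f hB).
suff <- : s = S f by exact: hs.
by apply/esym/(@cvg_lim _ _ _ _ _ _ _ hs); exact: norm_hausdorff.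
Qed.

Lemma energy_polar f g :
  (energy theta (f + g)%R = energy theta (f - g)%R + (4 * rdot (S f) g)%:E)%E.
Proof.
have fin : (\esum_(v in [set: V]) (sqmod (inner f (theta v)))%:E < +oo)%E.
  exact: bessel_lty hB.
have := has_sum_polar _ _ _ _ g hB fin (frame_operator_has_sum f).
rewrite /energy; under eq_esum do rewrite -innerDl.
move=> ->; congr (_ + _)%E; apply: eq_esum => v _.
by rewrite innerBl.
Qed.

Lemma energyN f : energy theta (- f) = energy theta f.
Proof.
by apply: eq_esum => v _; rewrite innerNl sqmodN.
Qed.

Lemma energy_i f : energy theta ('i%C *: f) = energy theta f.
Proof. by apply: eq_esum => v _; rewrite innerZl sqmod_i. Qed.

Lemma energyE f : energy theta f = (rdot (S f) f)%:E.
Proof.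
have fin : (\esum_(v in [set: V]) (sqmod (inner f (theta v)))%:E < +oo)%E.
  exact: bessel_lty hB.
rewrite -(fineK (energy_fin_num _ _ f hB)); congr EFin.
apply: (norm_cvg_unique (cvg_esum _ (fun v => sqmod_ge0 (inner f (theta v))) fin)).
have : (fun J : {fset V} => rdot (partial_sum (fun v => inner f (theta v) *: theta v) J) f)
    @ totally --> rdot (S f) f by exact: cvg_rdot (frame_operator_has_sum f).
apply: cvg_trans; apply: near_eq_cvg; apply: nearW => J /=.
rewrite partial_sumE rdot_suml; apply: eq_bigr => v _.
by case: (inner f _) => p q; rewrite /sqmod/=; ring.
Qed.

(** The polarized energy is symmetric in its two arguments.  The linearity of the
    frame operator then follows by testing against all vectors. *)
Lemma rdot_frame_operatorC f g : rdot (S f) g = rdot f (S g).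
Proof.
have h1 := energy_polar f g; have := energy_polar g f.
rewrite [(g + f)%R]addrC h1 -(opprB f g) energyN.
rewrite -(fineK (energy_fin_num _ _ (f - g) hB)) -!EFinD => -[].
by rewrite (rdotC f); lra.
Qed.

Lemma frame_operatorD f g : S (f + g) = S f + S g.
Proof.
apply: rdot_ext => y.
by rewrite rdotDl !rdot_frame_operatorC rdotDl.
Qed.

Lemma frame_operatorN f : S (- f) = - S f.
Proof. by apply: rdot_ext => y; rewrite rdotNl !rdot_frame_operatorC rdotNl. Qed.

Lemma rdot_i f g : rdot ('i%C *: f) g = - rdot f ('i%C *: g).
Proof.
by rewrite -Im_inner /rdot innerZl; case: (inner f g) => p q /=; ring.
Qed.

(** Multiplication by i moves from one argument of the polarized energy to the
    other, since it preserves the energy. *)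
Lemma frame_operator_i f : S ('i%C *: f) = 'i%C *: S f.
Proof.
apply: rdot_ext => y.
have h1 := energy_polar ('i%C *: f) y; have h2 := energy_polar f ('i%C *: y).
have e1 : energy theta ('i%C *: f + y) = energy theta (f - 'i%C *: y).
  rewrite -[RHS]energy_i scalerBr scalerA.
  by rewrite -[X in X *: y]expr2 sqr_i scaleN1r opprK.
have e2 : energy theta ('i%C *: f - y) = energy theta (f + 'i%C *: y).
  rewrite -[RHS]energy_i scalerDr scalerA.
  by rewrite -[X in X *: y]expr2 sqr_i scaleN1r.
move: h1; rewrite e1 e2 h2 rdot_i.
rewrite -(fineK (energy_fin_num _ _ (f - 'i%C *: y) hB)) -!EFinD => -[].
lra.
Qed.

Lemma inner_frame_operatorC f g : inner (S f) g = inner f (S g).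
Proof.
by apply: inner_ext; rewrite rdot_frame_operatorC// frame_operator_i.
Qed.

Lemma sqnorm_frame_operator f : sqnorm (S f) <= B * rdot (S f) f.
Proof.
have fin : (\esum_(v in [set: V]) (sqmod (inner f (theta v)))%:E < +oo)%E.
  exact: bessel_lty hB.
have := has_sum_sqnorm_le _ _ _ _ hB (frame_operator_has_sum f) fin.
by rewrite -/(energy theta f) energyE.
Qed.

End FrameOperator.

End BesselFamilies.

(** * Coercive operators are onto *)

Section Coercive.
Context {R : realType} {H : hilbertType R}.

(** Banach iteration of u + t (y - S u).  The error is multiplied by 1 - t S,
    whose squared norm is at most 1 - 2 t A + t^2 M as soon as M bounds the
    squared norm of S; t = A / M makes this 1 - A^2 / M.  Taking M larger than
    B + A^2 keeps this quantity in [0, 1). *)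
Lemma coercive_surjective (S : H -> H) (A B : R) :
  0 < A -> (forall f g, S (f - g) = S f - S g) ->
  (forall f, A * sqnorm f <= rdot (S f) f) ->
  (forall f, sqnorm (S f) <= B * sqnorm f) ->
  forall y, exists u, S u = y.
Proof.
move=> A0 SB coer bnd y.
have [[x x0]|triv] := pselect (exists x : H, 0 < sqnorm x); last first.
  exists 0; apply/eqP; rewrite -subr_eq0; apply/eqP/sqnorm_eq0/eqP.
  rewrite eq_le sqnorm_ge0 andbT leNgt; apply/negP => h.
  by apply: triv; exists (S 0 - y).
have B0 : 0 <= B.
  by rewrite -(pmulr_lge0 _ x0) (le_trans _ (bnd x))// sqnorm_ge0.
pose M := B + A ^+ 2 + 1.
have M0 : 0 < M by rewrite /M -addrA ltr_wpDl// ltr_pwDr// sqr_ge0.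
pose t := A / M; have t0 : 0 < t by rewrite divr_gt0.
pose q := 1 - A ^+ 2 / M.
have q1 : q < 1 by rewrite ltrBlDr ltrDl divr_gt0// exprn_gt0.
have q0 : 0 <= q.
  by rewrite subr_ge0 ler_pdivrMr// mul1r /M; lra.
pose G u := u + t%:C *: (y - S u).
have GB u v : G u - G v = (u - v) - t%:C *: S (u - v).
  by rewrite /G SB opprD addrACA -scalerBr; congr (_ + _);
     rewrite -scalerN; congr (_ *: _); rewrite opprB addrC subrKA opprB.
have Gq u v : sqnorm (G u - G v) <= q * sqnorm (u - v).
  rewrite GB; set d := u - v; rewrite sqnormB sqnormZr rdotZr.
  have h1 := coer d; have h2 := bnd d.
  have h3 : t ^+ 2 * sqnorm (S d) <= t ^+ 2 * (M * sqnorm d).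
    rewrite ler_pM2l ?exprn_gt0// (le_trans h2)// ler_wpM2r ?sqnorm_ge0//.
    by rewrite /M -addrA lerDl addr_ge0 ?sqr_ge0.
  have h4 : t * (A * sqnorm d) <= t * rdot d (S d).
    by rewrite ler_pM2l// rdotC.
  have h5 : t ^+ 2 * (M * sqnorm d) = A ^+ 2 / M * sqnorm d.
    by rewrite /t; field; rewrite gt_eqF.
  have h6 : t * (A * sqnorm d) = A ^+ 2 / M * sqnorm d.
    by rewrite /t; field; rewrite gt_eqF.
  rewrite /q mulrBl mul1r; lra.
pose x_ n := iter n G 0.
have xq k n : sqnorm (x_ (n + k)%N - x_ n) <= q ^+ n * sqnorm (x_ k - x_ 0%N).
  elim: n => [|n ih]; first by rewrite add0n expr0 mul1r.
  by rewrite addSn exprS -mulrA (le_trans (Gq _ _))// ler_wpM2l.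
(* A bound W on the orbit makes it Cauchy, as |x_(n+k) - x_n|^2 <= q^n W.  The
   weight (1 - q) / 2 in the cross term leaves a contraction factor
   1 - (1 - q) / 2 at the cost of a fixed additive error K. *)
have [W W0 xW] : exists2 W, 0 <= W & forall k, sqnorm (x_ k - x_ 0%N) <= W.
  pose d := sqnorm (x_ 1%N - x_ 0%N).
  have d0 : 0 <= d := sqnorm_ge0 _.
  have eta0 : 0 < (1 - q) / 2 by rewrite divr_gt0// subr_gt0.
  pose K := (1 + ((1 - q) / 2)^-1) * d.
  have K0 : 0 <= K by rewrite mulr_ge0// addr_ge0// invr_ge0 ltW.
  exists (K / ((1 - q) / 2)); first by rewrite divr_ge0// ltW.
  elim=> [|k ih]; first by rewrite subrr sqnorm0 divr_ge0// ltW.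
  set e := sqnorm (x_ k - x_ 0%N) in ih *.
  have -> : x_ k.+1 - x_ 0%N = (G (x_ k) - G (x_ 0%N)) + (x_ 1%N - x_ 0%N).
    by rewrite addrA subrK.
  rewrite sqnormD; have := rdot_young _ (G (x_ k) - G (x_ 0%N)) (x_ 1%N - x_ 0%N) eta0.
  have := Gq (x_ k) (x_ 0%N); rewrite -/d -/e.
  set w := sqnorm (G _ - _) => hw hr.
  have h1 : (1 + (1 - q) / 2) * w <= (1 - (1 - q) / 2) * e.
    have h2 : (1 + (1 - q) / 2) * w <= (1 + (1 - q) / 2) * (q * e).
      by rewrite ler_pM2l// ltr_wpDr// ltW.
    apply: (le_trans h2); rewrite mulrA ler_wpM2r ?sqnorm_ge0//.
    have := mulr_ge0 (ltW eta0) (ltW eta0); lra.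
  have h3 : (1 - (1 - q) / 2) * e <= (1 - (1 - q) / 2) * (K / ((1 - q) / 2)).
    by rewrite ler_wpM2l//; lra.
  have h4 : (1 - (1 - q) / 2) * (K / ((1 - q) / 2)) = K / ((1 - q) / 2) - K.
    by field; rewrite subr_eq0 gt_eqF.
  have h5 : K = d + ((1 - q) / 2)^-1 * d by rewrite /K mulrDl mul1r.
  lra.
have qn : (fun n => W * q ^+ n) @ \oo --> 0.
  rewrite -[0](mulr0 W); apply: cvgMr; apply: cvg_expr.
  by rewrite ger0_norm.
have [l xl] : exists l : H, x_ @ \oo --> l.
  apply: hilbert_complete => e e0.
  have e40 : 0 < e / 4 by rewrite divr_gt0.
  move/cvgrPdist_lt : qn => /(_ _ e40)[N _ hN].
  exists [set n | (N <= n)%N]; first by exists N.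
  have near0 n : (N <= n)%N -> sqnorm (x_ n - x_ N) < e / 4.
    move=> Nn; rewrite -(subnKC Nn) (le_lt_trans (xq _ _))//.
    have := hN N (leqnn N); rewrite /= sub0r normrN ger0_norm ?mulr_ge0 ?exprn_ge0//.
    by apply: le_lt_trans; rewrite mulrC ler_wpM2r ?exprn_ge0.
  move=> m n /= /near0 hm /near0 hn.
  have -> : x_ m - x_ n = (x_ m - x_ N) + (x_ N - x_ n) by rewrite addrA subrK.
  rewrite (le_lt_trans (sqnormD_le _ _))// [sqnorm (x_ N - x_ n)]sqnormBC; lra.
exists l.
have Gl : G l = l.
  suff xG : x_ @ \oo --> G l by exact: (norm_cvg_unique xG xl).
  rewrite -cvg_shiftS.
  apply/cvg_sqnormP => e e0; move/cvg_sqnormP : xl => /(_ e e0).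
  apply: filterS => n; apply: le_lt_trans.
  by rewrite (le_trans (Gq _ _))// ler_piMl ?sqnorm_ge0// ltW.
have : t%:C *: (y - S l) = 0 by apply: (addrI l); rewrite addr0.
move=> /eqP; rewrite scaler_eq0 => /orP[|].
  by rewrite -[0](rmorph0 (real_complex R)) (inj_eq (@complexI R)) gt_eqF.
by rewrite subr_eq0 => /eqP.
Qed.

End Coercive.

(** * Symmetric operators and projections *)

Section SymmetricOperators.
Context {R : realType} {H : hilbertType R}.

Definition symmetric_op (P : H -> H) := forall f g, inner (P f) g = inner f (P g).

Lemma symmetric_rdot P : symmetric_op P -> forall f g, rdot (P f) g = rdot f (P g).
Proof. by move=> h f g; rewrite /rdot h. Qed.

Lemma symmetric_opD P : symmetric_op P -> {morph P : f g / f + g}.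
Proof.
move=> /symmetric_rdot h f g; apply: rdot_ext => y.
by rewrite rdotDl !h rdotDl.
Qed.

Lemma symmetric_opB P : symmetric_op P -> {morph P : f g / f - g}.
Proof.
move=> /symmetric_rdot h f g; apply: rdot_ext => y.
by rewrite rdotBl !h rdotBl.
Qed.

Definition projection (P : H -> H) :=
  symmetric_op P /\ forall f, P (P f) = P f.

Lemma sqnorm_projection P f : projection P ->
  sqnorm f = sqnorm (P f) + sqnorm (f - P f).
Proof.
move=> [sP PP]; rewrite sqnormB.
have -> : rdot f (P f) = sqnorm (P f).
  by rewrite sqnormE symmetric_rdot// PP.
lra.
Qed.

Lemma sqnorm_projection_le P f : projection P -> sqnorm (P f) <= sqnorm f.
Proof.
by move=> hP; rewrite [leRHS](sqnorm_projection P)// lerDl sqnorm_ge0.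
Qed.

Lemma projection_id : projection id.
Proof. by split. Qed.

End SymmetricOperators.

(** * Frames of subspaces and their duals *)

Section FramesOfSubspaces.
Context {R : realType} {H : hilbertType R} {V : choiceType}.
Implicit Types (theta : V -> H) (f g y : H).

(** A frame of the range of the projection P, made of vectors of that range. *)
Definition frame_on (P : H -> H) theta (A B : R) :=
  [/\ 0 < A, 0 < B, forall v, P (theta v) = theta v &
   forall f, P f = f ->
     ((A * sqnorm f)%:E <= energy theta f <= (B * sqnorm f)%:E)%E].

Lemma frame_onP theta A B : frame theta A B <-> frame_on id theta A B.
Proof.
split=> [[A0 B0 h]|[A0 B0 _ h]]; split=> // f.
  by move=> _; have [h1 h2] := h f; apply/andP.
by have /andP[] := h f erefl.
Qed.

Context (P : H -> H) (theta : V -> H) (A B : R).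
Hypotheses (hP : projection P) (fr : frame_on P theta A B).
Local Notation S := (frame_operator theta).

Lemma inner_projection_frame f v : inner (P f) (theta v) = inner f (theta v).
Proof. by have [_ _ Pt _] := fr; rewrite hP.1 Pt. Qed.

Lemma energy_projection f : energy theta (P f) = energy theta f.
Proof. by apply: eq_esum => v _; rewrite inner_projection_frame. Qed.

Lemma frame_on_bessel : bessel theta B.
Proof.
have [_ B0 _ h] := fr; split=> // f; rewrite -energy_projection.
have /andP[_ /le_trans] := h (P f) (hP.2 f); apply.
by rewrite lee_fin ler_pM2l// sqnorm_projection_le.
Qed.

Let frame_operator_projection f : S (P f) = S f.
Proof.
rewrite /frame_operator; congr summability.sum; apply/funext => v.
by rewrite inner_projection_frame.
Qed.

Let projection_frame_operator f : P (S f) = S f.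
Proof.
apply: rdot_ext => y; rewrite symmetric_rdot; last exact: hP.1.
by rewrite !(rdot_frame_operatorC _ _ frame_on_bessel) frame_operator_projection.
Qed.

Lemma frame_operator_lower u : P u = u -> A * sqnorm u <= rdot (S u) u.
Proof.
have [_ _ _ h] := fr; move=> /h/andP[+ _].
by rewrite (energyE _ _ frame_on_bessel).
Qed.

(** The frame operator vanishes on the orthogonal complement of the range of
    P; adding A (1 - P) makes it coercive on the whole space. *)
Lemma frame_operator_onto y : exists u, P u = u /\ S u = P y.
Proof.
have [A0 B0 _ _] := fr; have hB := frame_on_bessel.
pose S1 f := S f + A%:C *: (f - P f).
have [|f|f|u hu] := @coercive_surjective _ _ S1 A (2 * B ^+ 2 + 2 * A ^+ 2) A0 _ _ _ (P y).
- move=> f g; rewrite /S1 (symmetric_opB _ hP.1).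
  rewrite -[f - g]/(f + - g) (frame_operatorD _ _ hB) (frame_operatorN _ _ hB).
  have -> : f + - g - (P f - P g) = (f - P f) - (g - P g).
    by rewrite !opprB [LHS]addrACA [RHS]addrACA [- g - _]addrC.
  by rewrite scalerBr opprD addrACA.
- rewrite rdotDl rdotZl rdotBl.
  have h1 := frame_operator_lower (P f) (hP.2 f).
  have h2 : rdot (S (P f)) (P f) = rdot (S f) f.
    rewrite frame_operator_projection -symmetric_rdot; last exact: hP.1.
    by rewrite projection_frame_operator.
  have h3 : rdot (P f) f = sqnorm (P f).
    by rewrite sqnormE -symmetric_rdot ?hP.2//; exact: hP.1.
  rewrite h2 in h1; rewrite -sqnormE h3; lra.
- apply: (le_trans (sqnormD_le _ _)); rewrite sqnormZr [leRHS]mulrDl; apply: lerD.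
    rewrite -mulrA ler_pM2l// (le_trans (sqnorm_frame_operator _ _ hB f))//.
    rewrite expr2 -mulrA ler_pM2l// -lee_fin -(energyE _ _ hB); exact: hB.2.
  rewrite -mulrA ler_pM2l// ler_pM2l ?exprn_gt0//.
  by rewrite [leRHS](sqnorm_projection P)// lerDr sqnorm_ge0.
exists (P u); split; first exact: hP.2.
rewrite frame_operator_projection -[RHS]hP.2 -hu.
rewrite (symmetric_opD _ hP.1) projection_frame_operator.
suff -> : P (A%:C *: (u - P u)) = 0 by rewrite addr0.
apply: rdot_ext => z; rewrite symmetric_rdot; last exact: hP.1.
rewrite rdotZl -symmetric_rdot; last exact: hP.1.
by rewrite (symmetric_opB _ hP.1) hP.2 subrr rdot0l mulr0.
Qed.

Lemma frame_operator_inj u w : P u = u -> P w = w -> S u = S w -> u = w.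
Proof.
have [A0 _ _ _] := fr; move=> Pu Pw Suw.
apply/eqP; rewrite -subr_eq0; apply/eqP/sqnorm_eq0/eqP.
rewrite eq_le sqnorm_ge0 andbT -(pmulr_rle0 _ A0).
have := frame_operator_lower (u - w).
rewrite (symmetric_opB _ hP.1) Pu Pw => /(_ erefl) /le_trans; apply.
rewrite -[u - w]/(u + - w) (frame_operatorD _ _ frame_on_bessel).
by rewrite (frame_operatorN _ _ frame_on_bessel) Suw subrr rdot0l.
Qed.

(** The dual family is the image of the frame under the inverse T of the frame
    operator.  Its energy at y is the energy of theta at T y, and the
    polarized energies differ by 4 Re <S (T y), f>. *)
Lemma frame_on_dual : exists psi : V -> H,
  [/\ forall v, P (psi v) = psi v, forall v, S (psi v) = theta v,
   forall y, P y = y ->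
     ((B^-1 * sqnorm y)%:E <= energy psi y <= (A^-1 * sqnorm y)%:E)%E &
   forall f y, P f = f -> P y = y ->
    (\esum_(v in [set: V]) (sqmod (inner f (theta v) + inner y (psi v)))%:E +
       (sqnorm (f - y))%:E =
     \esum_(v in [set: V]) (sqmod (inner f (theta v) - inner y (psi v)))%:E +
       (sqnorm (f + y))%:E)%E].
Proof.
have [A0 B0 Pt _] := fr; have hB := frame_on_bessel.
have [T hT] := choice frame_operator_onto.
have PT y : P (T y) = T y by have [] := hT y.
have ST y : P y = y -> S (T y) = y by move=> Py; have [_ ->] := hT y.
have dual y v : P y = y -> inner y (T (theta v)) = inner (T y) (theta v).
  move=> Py; rewrite -[in LHS](ST y Py) (inner_frame_operatorC _ _ hB).
  by rewrite ST.
exists (T \o theta); split=> [v|v|y Py|f y Pf Py] /=; first exact: PT.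
- by rewrite ST.
- have -> : energy (T \o theta) y = energy theta (T y).
    by apply: eq_esum => v _; rewrite /= dual.
  rewrite (energyE _ _ hB) (ST y Py) !lee_fin.
  have h1 := frame_operator_lower (T y) (PT y); rewrite (ST y Py) in h1.
  have h2 := sqnorm_frame_operator _ _ hB (T y); rewrite (ST y Py) in h2.
  apply/andP; split; first by rewrite ler_pdivrMl.
  have := rdot_young A^-1 y (T y); rewrite invr_gt0 invrK => /(_ A0); lra.
have polar := energy_polar _ _ hB (T y) f.
rewrite (ST y Py) in polar.
have -> : \esum_(v in [set: V]) (sqmod (inner f (theta v) + inner y (T (theta v))))%:E =
    energy theta (T y + f).
  by apply: eq_esum => v _; rewrite dual// innerDl addrC.
have -> : \esum_(v in [set: V]) (sqmod (inner f (theta v) - inner y (T (theta v))))%:E =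
    energy theta (T y - f).
  by apply: eq_esum => v _; rewrite dual// innerBl -sqmodN opprB.
rewrite polar -(fineK (energy_fin_num _ _ (T y - f) hB)) -!EFinD.
by congr EFin; rewrite sqnormB sqnormD (rdotC y f); ring.
Qed.

End FramesOfSubspaces.

(** * The canonical dual frame *)

Section CanonicalDual.
Context {R : realType} {H : hilbertType R} {V : choiceType}.

(** The frame operator is injective, so the choice made in the definition of the
    canonical dual has only one outcome. *)
Lemma canonical_dual_unique (theta : V -> H) A B v p :
  frame theta A B -> frame_operator theta p = theta v ->
  canonical_dual theta v = p.
Proof.
move=> /frame_onP fr hp.
have hq : frame_operator theta (canonical_dual theta v) = theta v.
  by apply: (@xgetPex _ 0 [set q | frame_operator theta q = theta v]); exists p.
by apply: (frame_operator_inj _ _ _ _ projection_id fr); rewrite ?hq.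
Qed.

Lemma frame_bessel (theta : V -> H) A B : frame theta A B -> bessel theta B.
Proof. by move=> /frame_onP fr; exact: (frame_on_bessel _ _ _ _ projection_id fr). Qed.

(** The case P = id of the construction of duals in a subspace. *)
Theorem canonical_dual_frame (theta : V -> H) A B : frame theta A B ->
  [/\ frame (canonical_dual theta) B^-1 A^-1,
      reconstruction theta (canonical_dual theta) &
      reconstruction (canonical_dual theta) theta].
Proof.
move=> fr; have [A0 B0 _] := fr.
have [psi [_ Spsi bounds polar]] :=
  frame_on_dual _ _ _ _ projection_id ((frame_onP _ _ _).1 fr).
have -> : canonical_dual theta = psi.
  by apply/funext => v; exact: canonical_dual_unique fr (Spsi v).
have frpsi : frame psi B^-1 A^-1.
  apply/frame_onP; split; rewrite ?invr_gt0//.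
have [] // := reconstruction_polarC _ _ _ _ (frame_bessel _ _ _ fr) (frame_bessel _ _ _ frpsi).
by move=> f y; exact: polar.
Qed.

(** The frame operator S is then the identity: |S t - t|^2 expands to at most
    <S t, t> - 2 <S t, t> + |t|^2 = 0. *)
Lemma parseval_canonical_dual (theta : V -> H) :
  (forall f, energy theta f = (sqnorm f)%:E) -> canonical_dual theta = theta.
Proof.
move=> parseval.
have fr : frame theta 1 1.
  split=> // f; rewrite mul1r.
  by have := parseval f; rewrite /energy => ->.
have hB := frame_bessel _ _ _ fr.
apply/funext => v; apply: (canonical_dual_unique _ _ _ _ _ fr).
set t := theta v; apply/eqP; rewrite -subr_eq0; apply/eqP/sqnorm_eq0/eqP.
rewrite eq_le sqnorm_ge0 andbT sqnormB.
have := sqnorm_frame_operator _ _ hB t; have := parseval t.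
rewrite (energyE _ _ hB) => -[]; lra.
Qed.

End CanonicalDual.

(** * Gluing frames along a resolution of the norm *)

Section Gluing.
Context {R : realType} {H : hilbertType R} (K : nat -> choiceType).
Let V : choiceType := {j : nat & K j}.

Lemma esum_sigma (a : V -> \bar R) : (forall v, 0 <= a v)%E ->
  \esum_(v in [set: V]) a v =
  \esum_(j in [set: nat]) \esum_(k in [set: K j]) a (existT _ j k).
Proof.
move=> a0; pose J j := [set v : V | projT1 v = j].
have -> : [set: V] = \bigcup_(j in [set: nat]) J j.
  by apply/seteqP; split=> // v _; exists (projT1 v).
rewrite esum_bigcupT//; last first.
  apply/trivIsetP => i j _ _ /eqP ij; apply/seteqP; split=> // v [vi vj].
  by apply: ij; rewrite -vi -vj.
apply: eq_esum => j _; apply: reindex_esum; split.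
- by move=> k _.
- by move=> k k' _ _ /eqP; rewrite eq_Tagged => /eqP.
- by move=> [i k] /= <-; exists k.
Qed.

Lemma esumZl (T : choiceType) (r : R) (a : T -> R) (s : R) : 0 <= r ->
  (forall i, 0 <= a i) -> \esum_(i in [set: T]) (a i)%:E = s%:E ->
  \esum_(i in [set: T]) (r * a i)%:E = (r * s)%:E.
Proof.
move=> r0 a0 as_.
have fin : (\esum_(i in [set: T]) (a i)%:E < +oo)%E by rewrite as_ ltry.
have ra0 i : 0 <= r * a i by rewrite mulr_ge0.
have fin' : (\esum_(i in [set: T]) (r * a i)%:E < +oo)%E.
  apply: (@le_lt_trans _ _ (r * s)%:E); last exact: ltry.
  apply: esum_le_bound => J; rewrite -mulr_sumr ler_wpM2l//.
  by rewrite -lee_fin -as_ sum_le_esum.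
rewrite -(fineK (esum_fin_num _ ra0 fin')); congr EFin.
have h1 := cvg_esum _ a0 fin; rewrite as_ /= in h1.
have h2 : (fun J : {fset T} => r * \sum_(v <- J) a v) @ totally --> r * s.
  exact: cvgMr.
apply: (norm_cvg_unique (cvg_esum _ ra0 fin')).
apply: cvg_trans h2; apply: near_eq_cvg; apply: nearW => J /=.
by rewrite mulr_sumr.
Qed.

Context (P M : nat -> H -> H) (theta : forall j, K j -> H) (A B : R).
Hypotheses (hP : forall j, projection (P j)) (hM : forall j, symmetric_op (M j)).
Hypothesis PM : forall j f, P j (M j f) = M j f.
Hypothesis M_parseval : forall f,
  \esum_(j in [set: nat]) (sqnorm (M j f))%:E = (sqnorm f)%:E.

Definition glued_family (psi : forall j, K j -> H) (v : V) : H :=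
  M (projT1 v) (psi (projT1 v) (projT2 v)).

Lemma energy_glued_family psi f :
  energy (glued_family psi) f = \esum_(j in [set: nat]) energy (psi j) (M j f).
Proof.
rewrite /energy esum_sigma; last by move=> v; rewrite lee_fin sqmod_ge0.
by apply: eq_esum => j _; apply: eq_esum => k _; rewrite /glued_family /= hM.
Qed.

(** Since the M j form a resolution of the norm, bounds that hold at every
    level j on the range of M j add up. *)
Lemma frame_glued_family psi A' B' : 0 < A' -> 0 < B' ->
  (forall j f, P j f = f ->
    (A' * sqnorm f)%:E <= energy (psi j) f <= (B' * sqnorm f)%:E)%E ->
  frame (glued_family psi) A' B'.
Proof.
move=> A0 B0 h; split=> // f; rewrite -/(energy (glued_family psi) f) energy_glued_family.
have n0 j := sqnorm_ge0 (M j f).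
rewrite -(esumZl _ A' _ _ (ltW A0) n0 (M_parseval f)).
rewrite -(esumZl _ B' _ _ (ltW B0) n0 (M_parseval f)).
by split; apply: le_esum => j _; have /andP[] := h j (M j f) (PM j f).
Qed.

(** Dualize at every level j and filter the result by M j again.  The polarized
    energy identity of the glued families at (f, y) is the sum over j of the
    identities at (M j f, M j y), so no iterated vector-valued sum is needed. *)
Theorem glued_family_dual : (forall j, frame_on (P j) (theta j) A B) ->
  frame (glued_family theta) A B /\
  exists psi, [/\ frame (glued_family psi) B^-1 A^-1,
    reconstruction (glued_family theta) (glued_family psi) &
    reconstruction (glued_family psi) (glued_family theta)].
Proof.
move=> fr; have [A0 B0 _ _] := fr 0%N.
have frt : frame (glued_family theta) A B.
  by apply: frame_glued_family => // j f; have [_ _ _] := fr j; exact.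
split=> //.
have dual j := cid (frame_on_dual _ _ _ _ (hP j) (fr j)).
pose psi j := projT1 (dual j); have hpsi j := projT2 (dual j).
have frp : frame (glued_family psi) B^-1 A^-1.
  apply: frame_glued_family; rewrite ?invr_gt0// => j f.
  by have [_ _ + _] := hpsi j; exact.
exists psi.
have [] // := reconstruction_polarC _ _ _ _ (frame_bessel _ _ _ frt) (frame_bessel _ _ _ frp).
move=> f y; rewrite -(M_parseval (f - y)) -(M_parseval (f + y)).
rewrite !esum_sigma; try by move=> v; rewrite lee_fin sqmod_ge0.
rewrite -!esumD; first last.
- by move=> j _; rewrite lee_fin sqnorm_ge0.
- by move=> j _; apply: esum_ge0 => k _; rewrite lee_fin sqmod_ge0.
- by move=> j _; rewrite lee_fin sqnorm_ge0.
- by move=> j _; apply: esum_ge0 => k _; rewrite lee_fin sqmod_ge0.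
apply: eq_esum => j _; have [_ _ _] := hpsi j.
move=> /(_ (M j f) (M j y) (PM j f) (PM j y)).
rewrite -(symmetric_opB _ (hM j)) -(symmetric_opD _ (hM j)) => polar.
under eq_esum do rewrite /glued_family /= -2!hM.
by under [X in _ = (X + _)%E]eq_esum do rewrite /glued_family /= -2!hM.
Qed.

End Gluing.

(** * Measurable fields of vectors *)

Section ComplexMeasurability.
Context {R : realType}.
Implicit Types (u v : R -> R[i]) (w : R -> R).

Lemma cmeasurable_ext u v : (forall l, 0 <= l -> u l = v l) ->
  cmeasurable u -> cmeasurable v.
Proof.
move=> uv [h1 h2]; split.
  apply: eq_measurable_fun h1 => l; rewrite inE/= in_itv/= andbT => l0.
  by rewrite uv.
apply: eq_measurable_fun h2 => l; rewrite inE/= in_itv/= andbT => l0.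
by rewrite uv.
Qed.

Lemma cmeasurableD u v : cmeasurable u -> cmeasurable v ->
  cmeasurable (fun l => u l + v l).
Proof.
move=> [u1 u2] [v1 v2]; split.
  rewrite (_ : (fun _ => _) = fun l => complex.Re (u l) + complex.Re (v l)).
    exact: measurable_funD.
  by apply/funext => l; rewrite raddfD.
rewrite (_ : (fun _ => _) = fun l => complex.Im (u l) + complex.Im (v l)).
  exact: measurable_funD.
by apply/funext => l; rewrite raddfD.
Qed.

Lemma cmeasurable_conj u : cmeasurable u -> cmeasurable (fun l => (u l)^*).
Proof.
move=> [u1 u2]; split.
  rewrite (_ : (fun _ => _) = fun l => complex.Re (u l))//.
  by apply/funext => l; rewrite Re_conjc.
rewrite (_ : (fun _ => _) = fun l => - complex.Im (u l)).
  exact: measurable_funN.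
by apply/funext => l; rewrite Im_conjc.
Qed.

Lemma cmeasurableZr w u : measurable_fun `[(0 : R), +oo[ w -> cmeasurable u ->
  cmeasurable (fun l => (w l)%:C * u l).
Proof.
move=> mw [u1 u2]; split.
  rewrite (_ : (fun _ => _) = fun l => w l * complex.Re (u l)).
    exact: measurable_funM.
  by apply/funext => l; rewrite ReZ.
rewrite (_ : (fun _ => _) = fun l => w l * complex.Im (u l)).
  exact: measurable_funM.
by apply/funext => l; rewrite ImZ.
Qed.

Lemma cmeasurable_i u : cmeasurable u -> cmeasurable (fun l => 'i%C * u l).
Proof.
move=> [u1 u2]; split.
  rewrite (_ : (fun _ => _) = fun l => - complex.Im (u l)).
    exact: measurable_funN.
  by apply/funext => l; case: (u l) => p q /=; ring.
rewrite (_ : (fun _ => _) = fun l => complex.Re (u l))//.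
by apply/funext => l; case: (u l) => p q /=; ring.
Qed.

Lemma cmeasurableZ (a : R[i]) u : cmeasurable u -> cmeasurable (fun l => a * u l).
Proof.
move=> mu; rewrite [a]complexE.
apply: (@cmeasurable_ext (fun l => (complex.Re a)%:C * u l +
    'i%C * ((complex.Im a)%:C * u l))).
  by move=> l _; rewrite mulrDl mulrA.
apply: cmeasurableD; first exact: cmeasurableZr.
by apply: cmeasurable_i; exact: cmeasurableZr.
Qed.

Lemma cmeasurable0 : cmeasurable (fun _ : R => 0 : R[i]).
Proof. by split => /=; exact: measurable_cst. Qed.

End ComplexMeasurability.

Section MeasurableFields.
Context {R : realType} (X : direct_integral R).
Local Notation e := (fundamental X).
Implicit Types (x y : vfield X).

Definition measurable_field x :=
  forall n, cmeasurable (fun l => inner (x l) (e n l)).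

Lemma measurable_fieldD x y : measurable_field x -> measurable_field y ->
  measurable_field (fun l => x l + y l).
Proof.
move=> hx hy n.
apply: (@cmeasurable_ext _ (fun l => inner (x l) (e n l) + inner (y l) (e n l))).
  by move=> l _; rewrite innerDl.
exact: cmeasurableD.
Qed.

Lemma measurable_fieldN x : measurable_field x -> measurable_field (fun l => - x l).
Proof.
move=> hx n.
apply: (@cmeasurable_ext _ (fun l => (-1) * inner (x l) (e n l))).
  by move=> l _; rewrite innerNl mulN1r.
exact: cmeasurableZ.
Qed.

Lemma measurable_field_multiply w x : measurable_fun `[(0 : R), +oo[ w ->
  measurable_field x -> measurable_field (multiply w x).
Proof.
move=> mw hx n.
apply: (@cmeasurable_ext _ (fun l => (w l)%:C * inner (x l) (e n l))).
  by move=> l _; rewrite /multiply innerZl.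
exact: cmeasurableZr.
Qed.

(** Combinations of the fundamental fields whose coefficients have rational
    real and imaginary parts; countably many of them suffice to be dense in
    every fiber. *)
Definition rational_field (s : seq (rat * rat)) : vfield X :=
  fun l => \sum_(i < size s) (ratr (s`_i).1 +i* ratr (s`_i).2) *: e i l.

Lemma inner_rational_field y s : measurable_field y ->
  cmeasurable (fun l => inner (y l) (rational_field s l)).
Proof.
move=> hy; rewrite /rational_field.
elim: (size s) => [|n ih].
  apply: cmeasurable_ext cmeasurable0 => l _.
  by rewrite big_ord0 linear0r.
apply: (cmeasurable_ext _ _ _ (cmeasurableD _ _ ih
  (cmeasurableZ (ratr (s`_n).1 +i* ratr (s`_n).2)^* _ (hy n)))) => l _.
by rewrite big_ord_recr/= innerDr innerZr.
Qed.

Lemma measurable_rational_field s : measurable_field (rational_field s).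
Proof.
move=> n; apply: (@cmeasurable_ext _ (fun l => (inner (e n l) (rational_field s l))^*)).
  by move=> l _; rewrite -innerC.
apply: cmeasurable_conj; apply: inner_rational_field => m.
exact: fundamental_measurable.
Qed.

Lemma rat_approx (a d : R) : 0 < d -> exists q : rat, (a - ratr q) ^+ 2 < d.
Proof.
move=> d0; have s0 : 0 < Num.sqrt d by rewrite sqrtr_gt0.
have /rat_in_itvoo[q] : a - Num.sqrt d < a + Num.sqrt d by lra.
rewrite inE/= => /andP[]; rewrite !bnd_simp => h1 h2; exists q.
rewrite -[ltRHS](sqr_sqrtr (ltW d0)) -real_normK ?num_real//.
rewrite ltr_pXn2r ?nnegrE ?(ltW s0)//; rewrite ltr_norml; apply/andP; split; lra.
Qed.

Lemma rational_approx l n (a : 'I_n -> R[i]) (d : R) : 0 < d ->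
  exists2 s, size s = n &
    sqnorm (\sum_(i < n) a i *: e i l - rational_field s l) < d.
Proof.
elim: n a d => [|n ih] a d d0.
  by exists [::] => //; rewrite /rational_field !big_ord0 subrr sqnorm0.
have d4 : 0 < d / 4 by rewrite divr_gt0.
have [s sn hs] := ih (fun i => a (widen_ord (leqnSn n) i)) _ d4.
set z := e n l; have z0 : 0 < sqnorm z + 1 by rewrite ltr_wpDl// sqnorm_ge0.
have k0 : 0 < d / 8 / (sqnorm z + 1) by rewrite !divr_gt0.
have [p hp] := rat_approx (complex.Re (a ord_max)) _ k0.
have [q hq] := rat_approx (complex.Im (a ord_max)) _ k0.
exists (rcons s (p, q)); first by rewrite size_rcons sn.
rewrite /rational_field size_rcons sn !big_ord_recr/= -/z.
have -> : (rcons s (p, q))`_n = (p, q) by rewrite nth_rcons sn ltnn eqxx.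
have -> : \sum_(i < n) (ratr ((rcons s (p, q))`_i).1 +i*
    ratr ((rcons s (p, q))`_i).2) *: e i l = rational_field s l.
  rewrite /rational_field sn; apply: eq_bigr => i _.
  by rewrite nth_rcons sn ltn_ord.
rewrite opprD addrACA -scalerBl (le_lt_trans (sqnormD_le _ _))//.
rewrite sqnormZ.
have hpq : sqmod (a ord_max - (ratr p +i* ratr q)) < d / 4 / (sqnorm z + 1).
  have -> : d / 4 / (sqnorm z + 1) = d / 8 / (sqnorm z + 1) + d / 8 / (sqnorm z + 1).
    by field; rewrite gt_eqF.
  move: hp hq; case: (a ord_max) => u v; rewrite /sqmod /=; lra.
have : sqmod (a ord_max - (ratr p +i* ratr q)) * sqnorm z <= d / 4.
  apply: (@le_trans _ _ (d / 4 / (sqnorm z + 1) * sqnorm z)).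
    by rewrite ler_wpM2r ?sqnorm_ge0// ltW.
  rewrite mulrAC ler_pdivrMr// ler_pM2l// lerDl; exact: ler01.
lra.
Qed.

Lemma rational_field_dense l (x : fiber X l) (d : R) : 0 <= l -> 0 < d ->
  exists s, sqnorm (x - rational_field s l) < d.
Proof.
move=> l0 d0; have d4 : 0 < d / 4 by rewrite divr_gt0.
have r0 : 0 < Num.sqrt (d / 4) by rewrite sqrtr_gt0.
have rC : 0 < (Num.sqrt (d / 4))%:C :> R[i] by rewrite ltcR.
have [] := @fundamental_total _ X l l0 (ball x (Num.sqrt (d / 4))%:C).
- by exists x; exact: ballxx.
- exact: ball_open.
move=> y [+ [n [a yE]]]; rewrite -ball_normE/= norm_lt_sqnorm// sqr_sqrtr ?ltW// => hxy.
have [s _ hs] := rational_approx l n a _ d4; exists s.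
have -> : x - rational_field s l = (x - y) + (y - rational_field s l).
  by rewrite addrA subrK.
by rewrite (le_lt_trans (sqnormD_le _ _))//; rewrite -yE in hs; lra.
Qed.

(** The squared norm of x l is the supremum of 2 Re <x l, y l> - |y l|^2
    over the countable dense family of rational fields y. *)
Lemma measurable_sqnorm x : measurable_field x ->
  measurable_fun `[(0 : R), +oo[ (fun l => sqnorm (x l)).
Proof.
move=> hx mD; apply: (measurability _ (RGenOInfty.measurableE R)) => //.
move=> /= _ [_ [a ->] <-]; rewrite preimage_itvoy.
pose phi s l := 2 * complex.Re (inner (x l) (rational_field s l)) -
  complex.Re (inner (rational_field s l) (rational_field s l)).
have phiE s l : phi s l = sqnorm (x l) - sqnorm (x l - rational_field s l).
  by rewrite /phi -!/(rdot _ _) sqnormB -sqnormE; lra.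
have mphi s : measurable_fun `[(0 : R), +oo[ (phi s).
  apply: measurable_funB.
    apply: measurable_funM => //.
    exact: (inner_rational_field _ _ hx).1.
  exact: (inner_rational_field _ _ (measurable_rational_field s)).1.
rewrite [X in measurable X](_ : _ = \bigcup_(s in [set: seq (rat * rat)])
    (`[(0 : R), +oo[ `&` [set l | a < phi s l])).
  apply: countable_bigcupT_measurable; first exact: countableP.
  move=> s; rewrite -preimage_itvoy; apply: mphi => //.
apply/seteqP; split=> [l [Dl /= al]|l [s _ [Dl /= al]]]; last first.
  by split=> //; rewrite (lt_le_trans al)// phiE gerBl sqnorm_ge0.
have l0 : 0 <= l by move: Dl; rewrite /= in_itv/= andbT.
have d0 : 0 < sqnorm (x l) - a by rewrite subr_gt0.
have [s hs] := rational_field_dense l (x l) _ l0 d0.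
by exists s => //; split => //=; rewrite phiE; lra.
Qed.

End MeasurableFields.

(** * The norm of a direct integral *)

#[local] Instance base_ae_filter {R : realType} (X : direct_integral R) :
  Filter (nbhs (almost_everywhere (base X))).
Proof. exact: ae_filter_ringOfSetsType. Qed.

Section DirectIntegralNorm.
Context {R : realType} (X : direct_integral R).
Implicit Types (x y z : vfield X) (w : R -> R).

Lemma vfield_eq_refl x : vfield_eq x x.
Proof. by apply: aeW => l _. Qed.

Lemma vfield_eq_trans x y z : vfield_eq x y -> vfield_eq y z -> vfield_eq x z.
Proof. by apply: filterS2 => l h1 h2 l0; rewrite h1// h2. Qed.

Lemma vfield_eqD x x' y y' : vfield_eq x x' -> vfield_eq y y' ->
  vfield_eq (fun l => x l + y l) (fun l => x' l + y' l).
Proof. by apply: filterS2 => l h1 h2 l0; rewrite h1// h2. Qed.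

Lemma vfield_eqB x x' y y' : vfield_eq x x' -> vfield_eq y y' ->
  vfield_eq (fun l => x l - y l) (fun l => x' l - y' l).
Proof. by apply: filterS2 => l h1 h2 l0; rewrite h1// h2. Qed.

Lemma in_half_line (l : R) : [set` `[(0 : R), +oo[] l -> 0 <= l.
Proof. by rewrite /= in_itv/= andbT. Qed.

Lemma vfield_sqnorm_eq x y : measurable_field X x -> measurable_field X y ->
  vfield_eq x y -> vfield_sqnorm x = vfield_sqnorm y.
Proof.
move=> mx my xy; apply: ge0_ae_eq_integral => //.
- by apply/measurable_EFinP; exact: measurable_sqnorm.
- by apply/measurable_EFinP; exact: measurable_sqnorm.
- by move=> l _; rewrite lee_fin sqnorm_ge0.
- by move=> l _; rewrite lee_fin sqnorm_ge0.
by apply: filterS xy => l h Dl; rewrite h//; exact: in_half_line.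
Qed.

Lemma vfield_sqnormD x y : measurable_field X x -> measurable_field X y ->
  (vfield_sqnorm x + vfield_sqnorm y =
   \int[base X]_(l in `[0%R : R, +oo[) (sqnorm (x l) + sqnorm (y l))%:E)%E.
Proof.
move=> mx my; rewrite /vfield_sqnorm -ge0_integralD//.
- by move=> l _; rewrite lee_fin sqnorm_ge0.
- by apply/measurable_EFinP; exact: measurable_sqnorm.
- by move=> l _; rewrite lee_fin sqnorm_ge0.
- by apply/measurable_EFinP; exact: measurable_sqnorm.
Qed.

Lemma vfield_sqnorm_multiply_le w x (M : R) : 0 <= M ->
  measurable_fun `[(0 : R), +oo[ w -> (forall l, 0 <= l -> `|w l| <= M) ->
  measurable_field X x ->
  (vfield_sqnorm (multiply w x) <= (M ^+ 2)%:E * vfield_sqnorm x)%E.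
Proof.
move=> M0 mw wM mx; have n0 l : (0 <= (sqnorm (x l))%:E)%E by rewrite lee_fin sqnorm_ge0.
have ms : measurable_fun `[(0 : R), +oo[ (fun l => (sqnorm (x l))%:E).
  by apply/measurable_EFinP; exact: measurable_sqnorm.
rewrite /vfield_sqnorm -ge0_integralZl_EFin ?exprn_ge0//.
apply: ge0_le_integral => //.
- by move=> l _; rewrite lee_fin sqnorm_ge0.
- by apply/measurable_EFinP; apply: measurable_sqnorm; exact: measurable_field_multiply.
- by apply: emeasurable_funM.
move=> l /in_half_line l0; rewrite lee_fin /multiply sqnormZr ler_wpM2r ?sqnorm_ge0//.
by rewrite -real_normK ?num_real// ler_pXn2r ?nnegrE// wM.
Qed.

Lemma in_direct_integral_multiply w x (M : R) : 0 <= M ->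
  measurable_fun `[(0 : R), +oo[ w -> (forall l, 0 <= l -> `|w l| <= M) ->
  in_direct_integral x -> in_direct_integral (multiply w x).
Proof.
move=> M0 mw wM [mx fx]; split; first exact: measurable_field_multiply.
apply: (le_lt_trans (vfield_sqnorm_multiply_le _ _ _ M0 mw wM mx)).
by apply: lte_mul_pinfty => //; rewrite lee_fin exprn_ge0.
Qed.

End DirectIntegralNorm.

(** * Spectral multipliers *)

Section Multipliers.
Context {R : realType} {H : hilbertType R} {X : direct_integral R}
  (F : H -> vfield X) (uF : unitary_transform F).
Implicit Types (f g : H) (w u : R -> R).

Lemma transform_field f : measurable_field X (F f).
Proof. by have [h _ _ _] := uF; have [] := h f. Qed.

Lemma transform_norm f : vfield_sqnorm (F f) = (sqnorm f)%:E.
Proof. by have [_ _ h _] := uF. Qed.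

Lemma transformP (a : R[i]) f g :
  vfield_eq (F (a *: f + g)) (fun l => a *: F f l + F g l).
Proof. by have [_ h _ _] := uF. Qed.

Lemma transformD f g : vfield_eq (F (f + g)) (fun l => F f l + F g l).
Proof.
have := transformP 1 f g; rewrite scale1r.
by apply: filterS => l h /h ->; rewrite scale1r.
Qed.

Lemma transformB f g : vfield_eq (F (f - g)) (fun l => F f l - F g l).
Proof.
have := transformP (-1) g f; rewrite scaleN1r addrC.
by apply: filterS => l h /h ->; rewrite scaleN1r addrC.
Qed.

Lemma transform0 : vfield_eq (F 0) (fun l => 0).
Proof.
have := transformB 0 0; rewrite subrr.
by apply: filterS => l h /h ->; rewrite subrr.
Qed.

Lemma transformZ (a : R[i]) f : vfield_eq (F (a *: f)) (fun l => a *: F f l).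
Proof.
have := transformP a f 0; rewrite addr0; apply: filterS2 transform0 => l h0 h l0.
by rewrite h// h0// addr0.
Qed.

Lemma sqnorm_transform f x : measurable_field X x -> vfield_eq (F f) x ->
  (sqnorm f)%:E = vfield_sqnorm x.
Proof.
move=> mx fx; rewrite -transform_norm.
by apply: vfield_sqnorm_eq => //; exact: transform_field.
Qed.

(** A vector whose transform vanishes almost everywhere has norm zero. *)
Lemma transform_inj f g : vfield_eq (F f) (F g) -> f = g.
Proof.
move=> fg; apply/eqP; rewrite -subr_eq0; apply/eqP/sqnorm_eq0.
have fg0 : vfield_eq (F (f - g)) (fun l => 0).
  apply: filterS2 (transformB f g) fg => l h1 h2 l0.
  by rewrite h1// h2// subrr.
apply: EFin_inj; rewrite (sqnorm_transform _ (fun l => 0) _ fg0).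
  by rewrite /vfield_sqnorm integral0_eq// => l _; rewrite sqnorm0.
move=> n; apply: cmeasurable_ext cmeasurable0 => l _.
by rewrite linear0l.
Qed.

Lemma spectral_calculusP w f : in_direct_integral (multiply w (F f)) ->
  vfield_eq (F (spectral_calculus F w f)) (multiply w (F f)).
Proof.
move=> h; have [_ _ _ /(_ _ h)[p hp]] := uF.
by apply: (@xgetPex _ 0 [set f' | vfield_eq (F f') (multiply w (F f))]); exists p.
Qed.

Definition bounded_symbol w :=
  measurable_fun `[(0 : R), +oo[ w /\
  exists2 M, 0 <= M & forall l, 0 <= l -> `|w l| <= M.

Lemma bounded_symbolP w f : bounded_symbol w ->
  vfield_eq (F (spectral_calculus F w f)) (multiply w (F f)).
Proof.
move=> [mw [M M0 wM]]; apply: spectral_calculusP.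
by apply: (in_direct_integral_multiply _ _ _ _ M0 mw wM); have [h _ _ _] := uF.
Qed.

(** Symmetry of w(sqrt L) comes from the pointwise identity
    |w x + y|^2 + |x - w y|^2 = |w x - y|^2 + |x + w y|^2, integrated; it only
    involves the norms, which are all that the transform preserves by
    definition. *)
Lemma spectral_calculus_symmetric w : bounded_symbol w ->
  symmetric_op (spectral_calculus F w).
Proof.
move=> hw; set T := spectral_calculus F w.
have TE f : vfield_eq (F (T f)) (multiply w (F f)) := bounded_symbolP w f hw.
have mF := transform_field.
have mT f : measurable_field X (multiply w (F f)).
  by apply: measurable_field_multiply => //; exact: hw.1.
have real_part f g : rdot (T f) g = rdot f (T g).
  have n1 : (sqnorm (T f + g) + sqnorm (f - T g))%:E =
      (sqnorm (T f - g) + sqnorm (f + T g))%:E.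
    have m1 := measurable_fieldD X _ _ (mT f) (mF g).
    have m2 := measurable_fieldD X _ _ (mF f) (measurable_fieldN X _ (mT g)).
    have m3 := measurable_fieldD X _ _ (mT f) (measurable_fieldN X _ (mF g)).
    have m4 := measurable_fieldD X _ _ (mF f) (mT g).
    rewrite !EFinD.
    rewrite (sqnorm_transform _ _ m1); last first.
      apply: vfield_eq_trans (transformD _ _) _.
      exact: vfield_eqD (TE f) (vfield_eq_refl X _).
    rewrite (sqnorm_transform _ _ m2); last first.
      apply: vfield_eq_trans (transformB _ _) _.
      exact: vfield_eqB (vfield_eq_refl X _) (TE g).
    rewrite (sqnorm_transform _ _ m3); last first.
      apply: vfield_eq_trans (transformB _ _) _.
      exact: vfield_eqB (TE f) (vfield_eq_refl X _).
    rewrite (sqnorm_transform _ _ m4); last first.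
      apply: vfield_eq_trans (transformD _ _) _.
      exact: vfield_eqD (vfield_eq_refl X _) (TE g).
    rewrite !vfield_sqnormD//; apply: eq_integral => l _; congr EFin.
    by rewrite /multiply !sqnormB !sqnormD !rdotZl !rdotZr !sqnormZr; ring.
  case: n1; rewrite !sqnormB !sqnormD; lra.
have Ti g : T ('i%C *: g) = 'i%C *: T g.
  apply: transform_inj.
  apply: filterS2 (filterI (TE ('i%C *: g)) (TE g))
    (filterI (transformZ 'i%C g) (transformZ 'i%C (T g))) => l [h1 h2] [h3 h4] l0.
  by rewrite h1// h4// h2// /multiply h3// !scalerA mulrC.
by move=> f g; apply: inner_ext; rewrite real_part// Ti.
Qed.

Lemma spectral_calculusM w u v f : bounded_symbol w -> bounded_symbol u ->
  bounded_symbol v -> (forall l, 0 <= l -> w l * u l = v l) ->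
  spectral_calculus F w (spectral_calculus F u f) = spectral_calculus F v f.
Proof.
move=> hw hu hv wuv; apply: transform_inj.
apply: filterS2 (bounded_symbolP w (spectral_calculus F u f) hw)
  (filterI (bounded_symbolP u f hu) (bounded_symbolP v f hv)) => l h1 [h2 h3] l0.
by rewrite h1// h3// /multiply h2// /multiply scalerA -rmorphM/= wuv.
Qed.

Lemma sqnorm_spectral_calculus w f : bounded_symbol w ->
  (sqnorm (spectral_calculus F w f))%:E =
  (\int[base X]_(l in `[0%R : R, +oo[) ((w l) ^+ 2 * sqnorm (F f l))%:E)%E.
Proof.
move=> hw; rewrite (sqnorm_transform _ _ _ (bounded_symbolP w f hw)).
  by apply: eq_integral => l _; rewrite /multiply sqnormZr.
by apply: measurable_field_multiply; [exact: hw.1|exact: transform_field].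
Qed.

(** Monotone convergence: the squared windows add up to one at every
    frequency. *)
Lemma spectral_calculus_parseval (w : nat -> R -> R) :
  (forall j, bounded_symbol (w j)) ->
  (forall l, 0 <= l -> (fun n => \sum_(0 <= j < n) (w j l) ^+ 2) @ \oo --> (1 : R)) ->
  forall f, \esum_(j in [set: nat]) (sqnorm (spectral_calculus F (w j) f))%:E =
    (sqnorm f)%:E.
Proof.
move=> hw sum1 f.
rewrite -nneseries_esumT; last by move=> j; rewrite lee_fin sqnorm_ge0.
under eq_eseriesr do rewrite sqnorm_spectral_calculus//.
rewrite -integral_nneseries//.
- rewrite -transform_norm; apply: eq_integral => l; rewrite inE => /in_half_line l0.
  apply: cvg_lim => //.
  rewrite [X in X @ _ --> _](_ : _ = EFin \o
      (fun n => \sum_(0 <= j < n) (w j l) ^+ 2 * sqnorm (F f l))); last first.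
    by apply/funext => n /=; rewrite sumEFin.
  apply: cvg_EFin; first by near=> n.
  rewrite [X in X @ _ --> _](_ : _ =
      (fun n => (\sum_(0 <= j < n) (w j l) ^+ 2) * sqnorm (F f l))); last first.
    by apply/funext => n /=; rewrite mulr_suml.
  by rewrite -[X in _ --> X]mul1r; apply: cvgMl; exact: sum1.
- move=> j; apply/measurable_EFinP; apply: measurable_funM.
    by apply: measurable_funX; exact: (hw j).1.
  by apply: measurable_sqnorm; exact: transform_field.
- by move=> j l _; rewrite lee_fin mulr_ge0 ?sqr_ge0 ?sqnorm_ge0.
Unshelve. all: by end_near. Qed.

End Multipliers.

(** * Band-limited vectors *)

Section PaleyWiener.
Context {R : realType} {H : hilbertType R} {X : direct_integral R}
  (F : H -> vfield X) (uF : unitary_transform F).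
Implicit Types (f g : H) (w : R -> R) (a b : R).

Lemma spectral_calculus_band w a b f : bounded_symbol w ->
  (forall l, 0 <= l -> ~~ (a <= l <= b) -> w l = 0) ->
  paley_wiener F a b (spectral_calculus F w f).
Proof.
move=> hw w0; apply: filterS (bounded_symbolP F uF w f hw) => l h l0 lab.
by rewrite h// /multiply w0// scale0r.
Qed.

Lemma spectral_calculus_fixed w a b f : bounded_symbol w ->
  (forall l, 0 <= l -> a <= l <= b -> w l = 1) ->
  paley_wiener F a b f -> spectral_calculus F w f = f.
Proof.
move=> hw w1 hf; apply: (transform_inj F uF).
apply: filterS2 (bounded_symbolP F uF w f hw) hf => l h1 h2 l0.
rewrite h1// /multiply; have [lab|lab] := boolP (a <= l <= b).
  by rewrite w1// scale1r.
by rewrite h2// scaler0.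
Qed.

(** The symbol of the projection onto the low frequencies. *)
Definition low_pass b : R -> R := \1_[set l | l <= b].

Lemma low_passE b l : low_pass b l = (l <= b)%R%:R.
Proof. by rewrite /low_pass indicE; congr (_%:R); rewrite mem_setE. Qed.

Lemma low_pass_bounded b : bounded_symbol (low_pass b).
Proof.
split.
  apply: measurable_indic; rewrite -set_itvNyc; exact: measurable_itv.
exists 1 => // l _; rewrite low_passE; case: (l <= b); by rewrite ?normr1 ?normr0.
Qed.

Lemma low_pass_projection b : projection (spectral_calculus F (low_pass b)).
Proof.
have hb := low_pass_bounded b; split.
  exact: spectral_calculus_symmetric.
move=> f; apply: spectral_calculusM => // l _.
by rewrite low_passE; case: (l <= b); rewrite ?mulr1 ?mulr0.
Qed.

Lemma low_pass_band b f : paley_wiener F 0 b (spectral_calculus F (low_pass b) f).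
Proof.
apply: spectral_calculus_band => [|l l0]; first exact: low_pass_bounded.
by rewrite l0 low_passE => /negbTE /= ->.
Qed.

Lemma low_pass_fixed b f : paley_wiener F 0 b f ->
  spectral_calculus F (low_pass b) f = f.
Proof.
apply: spectral_calculus_fixed => [|l _ /andP[_ lb]]; first exact: low_pass_bounded.
by rewrite low_passE lb.
Qed.

(** The low-pass multiplier is symmetric and fixes exactly the band-limited
    vectors; this determines the orthogonal projection onto them. *)
Lemma orthogonal_projectionE b f :
  orthogonal_projection (paley_wiener F 0 b) f = spectral_calculus F (low_pass b) f.
Proof.
set P := spectral_calculus F (low_pass b).
have [sP PP] : projection P := low_pass_projection b.
have fixP g : paley_wiener F 0 b g -> P g = g := low_pass_fixed b g.
rewrite /orthogonal_projection; set A := [set p | _].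
have AP : A (P f).
  split; first exact: low_pass_band.
  by move=> g /fixP <-; rewrite innerBl sP PP subrr.
have [Ax xf] : A (xget 0 A) by apply: (@xgetPex _ 0 A); exists (P f).
move: AP => [_ Pf].
apply/eqP; rewrite -subr_eq0; apply/eqP/sqnorm_eq0.
set p := xget 0 A in Ax xf *.
have pd : paley_wiener F 0 b (p - P f).
  have -> : p - P f = P (p - f).
    by rewrite (symmetric_opB _ sP) [P p](fixP _ Ax).
  exact: low_pass_band.
have -> : p - P f = (f - P f) - (f - p) by rewrite [RHS]addrC opprB subrKA.
have pd' : paley_wiener F 0 b ((f - P f) - (f - p)) by rewrite [X in paley_wiener _ _ _ X]addrC opprB subrKA.
by rewrite sqnormE rdotBl /rdot Pf// xf// subrr.
Qed.

(** On the band [0, b] the unbounded symbol l^m agrees with its product w by the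
    low-pass symbol, which is bounded by b^m. *)
Lemma band_limited_sobolev b m f : 0 <= b -> 0 <= m -> paley_wiener F 0 b f ->
  sobolev F m f /\ sqnorm (half_power F m f) <= b `^ (2 * m) * sqnorm f.
Proof.
move=> b0 m0 hf; pose w l := low_pass b l * l `^ m.
have mpow : measurable_fun `[(0 : R), +oo[ (fun l : R => l `^ m).
  by apply: measurable_funTS; exact: measurable_powR.
have mw : measurable_fun `[(0 : R), +oo[ w.
  by apply: measurable_funM => //; exact: (low_pass_bounded b).1.
have wM l : 0 <= l -> `|w l| <= b `^ m.
  move=> l0; rewrite /w low_passE; case: (leP l b) => lb; last first.
    by rewrite mul0r normr0 powR_ge0.
  by rewrite mul1r ger0_norm ?powR_ge0// ge0_ler_powR.
have ww : vfield_eq (multiply (fun l => l `^ m) (F f)) (multiply w (F f)).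
  apply: filterS hf => l h l0; rewrite /multiply /w low_passE.
  case: (leP l b) => lb; first by rewrite mul1r.
  by rewrite h ?l0/= -?ltNge// !scaler0.
have mF := transform_field F uF f.
have mp : measurable_field X (multiply (fun l => l `^ m) (F f)).
  exact: measurable_field_multiply.
have mpw : measurable_field X (multiply w (F f)) by exact: measurable_field_multiply.
have bm0 : 0 <= b `^ m by exact: powR_ge0.
have sob : sobolev F m f.
  split => //; rewrite (vfield_sqnorm_eq _ _ _ mp mpw ww).
  apply: (le_lt_trans (vfield_sqnorm_multiply_le _ _ _ _ bm0 mw wM mF)).
  by rewrite (transform_norm _ uF) -EFinM ltry.
split=> //; rewrite -lee_fin.
rewrite (sqnorm_transform _ uF _ _ mp (spectral_calculusP _ uF _ _ sob)).
rewrite (vfield_sqnorm_eq _ _ _ mp mpw ww).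
apply: (le_trans (vfield_sqnorm_multiply_le _ _ _ _ bm0 mw wM mF)).
by rewrite (transform_norm _ uF) -EFinM lee_fin [2 * m]mulrC powRrM powR_mulrn.
Qed.

End PaleyWiener.

(** * Dyadic windows *)

Section DyadicWindows.
Context {R : realType} (g : R -> R) (hg : cutoff g).
Local Notation w := (dyadic_window g).

Lemma cutoff_antitone (x y : R) : 0 <= x -> x <= y -> g y <= g x.
Proof. by have [_ h _ _ _] := hg; exact: h. Qed.

Lemma cutoff1 (x : R) : 0 <= x <= 1 -> g x = 1.
Proof. by have [_ _ _ h _] := hg; exact: h. Qed.

Lemma cutoff_itv (x : R) : 0 <= x -> 0 <= g x <= 1.
Proof. by have [_ _ _ _ h] := hg; exact: h. Qed.

Lemma cutoff0 (x : R) : 2 < x -> g x = 0.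
Proof.
move=> x2; have x0 : 0 <= x by rewrite ltW// (lt_trans _ x2).
have [_ _ supp _ _] := hg; apply/eqP; apply: contraT => gx.
have /supp : closure [set x : R | 0 <= x /\ g x != 0] x by apply: subset_closure.
by rewrite /= in_itv/= x0/= leNgt x2.
Qed.

(** The cutoff is monotone, hence measurable, on the half-line only; composing
    with the maximum with 0 makes it monotone on the whole line. *)
Lemma measurable_cutoff_scale (a : R) : 0 <= a ->
  measurable_fun `[(0 : R), +oo[ (fun l => g (a * l)).
Proof.
move=> a0; apply: (@eq_measurable_fun _ _ _ _ _ (fun l => g (Num.max 0 (a * l)))).
  move=> l; rewrite inE/= in_itv/= andbT => l0.
  by rewrite max_r// mulr_ge0.
apply: nonincreasing_measurable => // x y xy.
apply: cutoff_antitone; first by rewrite le_max lexx.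
by rewrite ge_max le_max lexx/= le_max ler_wpM2l ?orbT.
Qed.

Lemma half_scale (j : nat) (l : R) : 2 * (l / 2 ^+ j.+1) = l / 2 ^+ j.
Proof. by rewrite exprS; field; rewrite expf_neq0. Qed.

Lemma dyadic_windowS j (l : R) :
  w j.+1 l = Num.sqrt (g (l / 2 ^+ j.+1) - g (l / 2 ^+ j)).
Proof. by rewrite /dyadic_window half_scale. Qed.

Lemma dyadic_step_ge0 j (l : R) : 0 <= l -> 0 <= g (l / 2 ^+ j.+1) - g (l / 2 ^+ j).
Proof.
move=> l0; rewrite subr_ge0; apply: cutoff_antitone; first by rewrite divr_ge0// exprn_ge0.
by rewrite ler_wpM2l// lef_pV2 ?posrE ?exprn_gt0// ler_eXn2l// ltr1n.
Qed.

Lemma measurable_sqrt : measurable_fun [set: R] (@Num.sqrt R).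
Proof. by apply: nondecreasing_measurable => // x y; exact: ler_wsqrtr. Qed.

Lemma dyadic_window_bounded j : bounded_symbol (w j).
Proof.
split.
  case: j => [|j].
    apply: (measurableT_comp measurable_sqrt).
    apply: eq_measurable_fun (measurable_cutoff_scale 1 ler01) => l _.
    by rewrite mul1r.
  rewrite (_ : w j.+1 = Num.sqrt \o
      (fun l => g ((2 ^+ j.+1)^-1 * l) - g ((2 ^+ j)^-1 * l))); last first.
    by apply/funext => l; rewrite dyadic_windowS /= ![_^-1 * l]mulrC.
  apply: (measurableT_comp measurable_sqrt).
  by apply: measurable_funB; apply: measurable_cutoff_scale; rewrite invr_ge0 exprn_ge0.
exists 1 => // l l0.
have sqrt1 (r : R) : r <= 1 -> `|Num.sqrt r| <= 1.
  by move=> r1; rewrite ger0_norm ?sqrtr_ge0// -[leRHS]sqrtr1 ler_wsqrtr.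
case: j => [|j]; first by apply: sqrt1; have /andP[] := cutoff_itv l l0.
rewrite dyadic_windowS; apply: sqrt1.
have /andP[_ h1] : 0 <= g (l / 2 ^+ j.+1) <= 1 by rewrite cutoff_itv// divr_ge0// exprn_ge0.
have /andP[h2 _] : 0 <= g (l / 2 ^+ j) <= 1 by rewrite cutoff_itv// divr_ge0// exprn_ge0.
lra.
Qed.

Lemma dyadic_window_high j (l : R) : 0 <= l -> 2 ^+ j.+1 < l -> w j l = 0.
Proof.
move=> l0 jl.
have g0 i : (i <= j)%N -> g (l / 2 ^+ i) = 0.
  move=> ij; apply: cutoff0; rewrite ltr_pdivlMr ?exprn_gt0// -exprS.
  by rewrite (le_lt_trans _ jl)// ler_weXn2l// ?ler1n.
case: j jl g0 => [|j] jl g0; first by rewrite /dyadic_window -[l]divr1 -(expr0 2) g0// sqrtr0.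
by rewrite dyadic_windowS !g0// subrr sqrtr0.
Qed.

Lemma dyadic_window_low j (l : R) : 0 <= l -> l < 2 ^+ j -> w j.+1 l = 0.
Proof.
move=> l0 lj; rewrite dyadic_windowS.
have g1 i : (j <= i)%N -> g (l / 2 ^+ i) = 1.
  move=> ji; apply: cutoff1; rewrite divr_ge0 ?exprn_ge0//=.
  rewrite ler_pdivrMr ?exprn_gt0// mul1r (le_trans (ltW lj))//.
  by rewrite ler_weXn2l// ler1n.
by rewrite !g1// subrr sqrtr0.
Qed.

(** The squares of the windows telescope. *)
Lemma dyadic_window_sum n (l : R) : 0 <= l ->
  \sum_(0 <= j < n.+1) w j l ^+ 2 = g (l / 2 ^+ n).
Proof.
move=> l0; elim: n => [|n ih].
  rewrite big_nat1 expr0 divr1 /dyadic_window sqr_sqrtr//.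
  by have /andP[] := cutoff_itv l l0.
rewrite big_nat_recr// ih dyadic_windowS sqr_sqrtr ?dyadic_step_ge0//.
by rewrite /= addrC subrK.
Qed.

Lemma dyadic_window_partition (l : R) : 0 <= l ->
  (fun n => \sum_(0 <= j < n) w j l ^+ 2) @ \oo --> (1 : R).
Proof.
move=> l0; rewrite -cvg_shiftS; apply: cvg_near_cst.
exists (Num.bound l) => // n /= ln.
rewrite dyadic_window_sum//; apply: cutoff1; rewrite divr_ge0 ?exprn_ge0//=.
rewrite ler_pdivrMr ?exprn_gt0// mul1r (le_trans (ltW (archi_boundP l0)))//.
rewrite -natrX ler_nat (leq_trans ln)// ltnW// ltn_expl//.
Qed.

Context {H : hilbertType R} {X : direct_integral R}
  (F : H -> vfield X) (uF : unitary_transform F).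

Lemma dyadic_window_band j f : dyadic_band F j (spectral_calculus F (w j) f).
Proof.
have hw := dyadic_window_bounded j.
case: j hw => [|j] hw; apply: spectral_calculus_band => // l l0.
  by rewrite l0 andTb -ltNge => l2; apply: dyadic_window_high.
rewrite negb_and -!ltNge => /orP[lj|lj]; first exact: dyadic_window_low.
exact: dyadic_window_high.
Qed.

Lemma dyadic_window_low_pass j f :
  spectral_calculus F (low_pass (2 ^+ j.+1)) (spectral_calculus F (w j) f) =
  spectral_calculus F (w j) f.
Proof.
apply: (spectral_calculusM F uF) => [|||l l0].
- exact: low_pass_bounded.
- exact: dyadic_window_bounded.
- exact: dyadic_window_bounded.
rewrite low_passE; case: leP => hl; first by rewrite mul1r.
by rewrite mul0r dyadic_window_high.
Qed.

End DyadicWindows.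

(** * Sampling band-limited vectors *)

Section SamplingFrames.
Context {R : realType} {H : hilbertType R} {X : direct_integral R}
  (F : H -> vfield X) (uF : unitary_transform F).
Context (C c m0 : R) (K : choiceType) (A : K -> H -> R[i]) (mu : K -> H) (rho b : R).
Hypotheses (C0 : 0 < C) (c0 : 0 < c) (m00 : 0 <= m0) (b0 : 0 < b) (rho0 : 0 < rho).
Hypothesis samp : forall (m : R) (f : H), m0 < m -> sobolev F m f ->
  ((c%:E * (\esum_(k in [set: K]) (sqmod (A k f))%:E) <= (sqnorm f)%:E) /\
   ((sqnorm f)%:E <= C%:E * ((\esum_(k in [set: K]) (sqmod (A k f))%:E) +
       (rho `^ (2 * m) * sqnorm (half_power F m f))%:E)))%E.
Hypothesis mu_A : represents F m0 A mu.
Let P := spectral_calculus F (low_pass b).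
Let theta k := P (mu k).

(** On the band [0, b] the sampling inequality at order m has an error term of
    relative size (rho b)^(2 m). *)
Lemma sampling_band m f : m0 < m -> P f = f ->
  exists2 e, energy theta f = e%:E &
    c * e <= sqnorm f <= C * (e + (rho * b) `^ (2 * m) * sqnorm f).
Proof.
move=> mm Pf; have mge0 : 0 <= m by rewrite ltW// (le_lt_trans m00).
have hf : paley_wiener F 0 b f by rewrite -Pf; exact: low_pass_band.
have [sob hp] := band_limited_sobolev F uF b m f (ltW b0) mge0 hf.
have [sP PP] : projection P by exact: low_pass_projection.
have -> : energy theta f = \esum_(k in [set: K]) (sqmod (A k f))%:E.
  by apply: eq_esum => k _; rewrite /theta -sP Pf (mu_A k m).
have [h1 h2] := samp _ _ mm sob; set E := \esum_(k in _) _ in h1 h2 *.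
have E0 : (0 <= E)%E by apply: esum_ge0 => k _; rewrite lee_fin sqmod_ge0.
move: E E0 h1 h2 => [e| |] E0 h1 h2 //; last first.
  by move: h1; rewrite gt0_muley ?lte_fin.
exists e => //; rewrite -EFinM lee_fin in h1.
move: h2; rewrite -EFinD -EFinM lee_fin => h2; rewrite h1/= (le_trans h2)//.
rewrite ler_pM2l// lerD2l powRM ?(ltW rho0) ?(ltW b0)// -mulrA.
by rewrite ler_wpM2l// powR_ge0.
Qed.

(** The choice of rho makes the error term equal to delta |f|^2, which is
    absorbed by the left-hand side. *)
Lemma sampling_frame m delta : m0 < m -> 0 < delta < 1 ->
  rho `^ (2 * m) = C^-1 * b `^ (- (2 * m)) * delta ->
  frame_on P theta ((1 - delta) / C) c^-1.
Proof.
move=> mm /andP[d0 d1] rhoE; split.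
- by rewrite divr_gt0// subr_gt0.
- by rewrite invr_gt0.
- by move=> k; apply: (low_pass_projection F uF b).2.
move=> f Pf; have [e -> /andP[h1]] := sampling_band _ _ mm Pf.
rewrite powRM ?(ltW rho0) ?(ltW b0)// rhoE powRN => h2.
have bm : 0 < b `^ (2 * m) by rewrite powR_gt0.
have h3 : C * (e + C^-1 * (b `^ (2 * m))^-1 * delta * b `^ (2 * m) * sqnorm f) =
    C * e + delta * sqnorm f by field; rewrite !gt_eqF.
rewrite h3 in h2; rewrite !lee_fin; apply/andP; split; last by rewrite ler_pdivlMl.
rewrite mulrAC ler_pdivrMr// [e * C]mulrC; lra.
Qed.

(** The sampling inequality holds at every order.  With C = c = 1 the choice of
    rho forces rho b < 1, so letting the order tend to infinity kills the error
    term, and the frame of the band becomes tight. *)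
Lemma sampling_tight m delta f : C = 1 -> c = 1 -> m0 < m -> 0 < delta < 1 ->
  rho `^ (2 * m) = C^-1 * b `^ (- (2 * m)) * delta ->
  P f = f -> energy theta f = (sqnorm f)%:E.
Proof.
move=> C1 c1 mm /andP[d0 d1] rhoE Pf.
have m_gt0 : 0 < m by exact: le_lt_trans mm.
have rb0 : 0 <= rho * b by rewrite mulr_ge0// ltW.
have rb1 : rho * b < 1.
  rewrite ltNge; apply/negP => rb1.
  have : 1 <= (rho * b) `^ (2 * m).
    by rewrite -[leLHS](powRr0 (rho * b)) ler_powR// mulr_ge0// ltW.
  rewrite powRM ?(ltW rho0) ?(ltW b0)// rhoE powRN C1 invr1 mul1r mulrAC.
  by rewrite mulVf ?gt_eqF ?powR_gt0// mul1r leNgt d1.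
have [e Ee /andP[h1 _]] := sampling_band _ _ mm Pf.
rewrite c1 mul1r in h1.
rewrite Ee; congr EFin; apply/eqP; rewrite eq_le h1/=.
have cv : (fun n => e + (rho * b) ^+ 2 ^+ n * sqnorm f) @ \oo --> e + 0 * sqnorm f.
  apply: cvgD; first exact: cvg_cst.
  apply: cvgMl; apply: cvg_expr.
  by rewrite ger0_norm ?exprn_ge0// exprn_ilt1.
rewrite mul0r addr0 in cv.
apply: (@closed_cvg _ _ \oo _ _ [set r | sqnorm f <= r] _ _ _ cv); first exact: closed_ge.
exists (Num.bound m) => // n /= mn.
have mn' : m0 < n%:R.
  rewrite (lt_trans mm)// (lt_le_trans (archi_boundP (ltW m_gt0)))// ler_nat//.
have [e' Ee' /andP[_]] := sampling_band _ _ mn' Pf.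
have -> : e' = e by apply: EFin_inj; rewrite -Ee -Ee'.
by rewrite C1 mul1r -natrM powR_mulrn// exprM.
Qed.

End SamplingFrames.

(** * Frames of band-limited vectors *)

(* With c = C = 1 the frame bounds are 1 - delta and 1, and 1 and
   (1 - delta)^-1 for the canonical dual Psi.  For other c, C these values
   are false in general, and so is the band condition on Psi, because the frame
   operator need not preserve the bands; Theta is then a band-limited dual
   frame with the same bounds. *)
Theorem theorem6p7 (R : realType) (H : hilbertType R)
    (D : set H) (L : H -> H)
    (X : direct_integral R) (F : H -> vfield X)
    (C c m0 : R) (K : R -> choiceType)
    (A : forall rho : R, K rho -> H -> R[i])
    (delta m : R) (rho : nat -> R)
    (mu : forall j : nat, K (rho j) -> H)
    (g : R -> R)
    (L_sa : self_adjoint D L) (L_pos : positive D L)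
    (F_sft : spectral_fourier_transform D L F)
    (samp : sampling_assumption F C c m0 A)
    (delta01 : 0 < delta < 1) (m0_lt_m : m0 < m)
    (rho01 : forall j, 0 < rho j < 1)
    (rhoE : forall j,
       rho j `^ (2 * m) = C^-1 * (2 ^+ j.+1) `^ (- (2 * m)) * delta)
    (mu_A : forall j, represents F m0 (A (rho j)) (mu j))
    (g_cutoff : cutoff g) :
  let V : choiceType := {j : nat & K (rho j)} in
  let Phi : V -> H := multiscale_family F g mu in
  let Psi : V -> H := canonical_dual Phi in
  [/\ (forall v, dyadic_band F (projT1 v) (Phi v)),
      frame Phi ((1 - delta) / C) c^-1,
      frame Psi c (C / (1 - delta)) &
      reconstruction Phi Psi /\ reconstruction Psi Phi] /\
  (exists Theta : V -> H,
     [/\ forall v, dyadic_band F (projT1 v) (Theta v),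
         frame Theta c (C / (1 - delta)),
         reconstruction Phi Theta &
         reconstruction Theta Phi]) /\
  (c = 1 -> C = 1 ->
     [/\ frame Phi (1 - delta) 1,
         (forall v, dyadic_band F (projT1 v) (Psi v)) &
         frame Psi 1 (1 - delta)^-1]).
Proof.
move=> V Phi Psi.
have [uF _ _] := F_sft; have [C0 c0 m00 samp_rho] := samp.
have hw := dyadic_window_bounded g g_cutoff.
pose M j := spectral_calculus F (dyadic_window g j).
pose P j := spectral_calculus F (low_pass (2 ^+ j.+1)).
pose theta j k := P j (mu j k).
have PhiE : Phi = glued_family (fun j => K (rho j)) M theta.
  by apply/funext => v; rewrite /Phi /multiscale_family /= orthogonal_projectionE.
have hP j : projection (P j) by exact: low_pass_projection.
have hM j : symmetric_op (M j) by exact: spectral_calculus_symmetric.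
have PM j f : P j (M j f) = M j f by exact: dyadic_window_low_pass.
have parseval f : \esum_(j in [set: nat]) (sqnorm (M j f))%:E = (sqnorm f)%:E.
  by apply: spectral_calculus_parseval => // l l0; exact: dyadic_window_partition.
have band psi v : dyadic_band F (projT1 v) (glued_family (fun j => K (rho j)) M psi v).
  exact: dyadic_window_band.
have w0 j : 0 < 2 ^+ j.+1 :> R by rewrite exprn_gt0.
have r0 j : 0 < rho j by have /andP[] := rho01 j.
have sampj j := (samp_rho _ (rho01 j)).2.
have fr j : frame_on (P j) (theta j) ((1 - delta) / C) c^-1.
  exact: (sampling_frame F uF C c m0 _ _ _ (rho j) _ C0 c0 m00 (w0 j) (r0 j)
    (sampj j) (mu_A j) m delta).
have [frPhi [psi [frTheta recPT recTP]]] :=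
  glued_family_dual _ P M theta _ _ hP hM PM parseval fr.
rewrite -PhiE in frPhi recPT recTP.
have [frPsi recPhiPsi recPsiPhi] := canonical_dual_frame _ _ _ frPhi.
rewrite !invrK invf_div in frPsi frTheta.
split; first by split=> // v; rewrite PhiE; exact: band.
split; first by exists (glued_family (fun j => K (rho j)) M psi); split.
move=> c1 C1.
have PsiE : Psi = Phi.
  apply: parseval_canonical_dual => f; rewrite PhiE energy_glued_family// -parseval.
  apply: eq_esum => j _.
  exact: (sampling_tight F uF C c m0 _ _ _ (rho j) _ C0 c0 m00 (w0 j) (r0 j)
    (sampj j) (mu_A j) m delta (M j f) C1 c1 m0_lt_m delta01 (rhoE j) (PM j f)).
split.
- by move: frPhi; rewrite c1 C1 invr1 mulr1.
- by move=> v; rewrite PsiE PhiE; exact: band.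
- by move: frPsi; rewrite c1 C1 mul1r.
Qed.
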